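(* Let $a\le x_1<\cdots<x_n\le b$ be any (distinct) set of design points. The tridiagonal matrix $\mathbb{K}^2_n$ and the diagonal matrix $\mathbb{W}^2_n=\mathrm{diag}\big((x_3-x_1)/2,\ldots,(x_n-x_{n-2})/2\big)$ are $(3,1)$-spectrally-similar, where $\mathbb{K}^2_n\in\mathbb{R}^{(n-2)\times(n-2)}$ is the symmetric matrix whose inverse is the tridiagonal matrix described in the context. Consequently: let $y\in\mathbb{R}^n$. If $\hat f$ is the solution in the cubic smoothing spline problem $$\min_f\;\sum_{i=1}^n(y_i-f(x_i))^2+\lambda_a\int_a^b(D^2f)(x)^2\,dx$$ with tuning parameter $\lambda_a\ge0$, and $\hat\theta$ is the solution in the weighted cubic Bohlmann-Whittaker filtering problem $$\min_{\theta\in\mathbb{R}^n}\;\|y-\theta\|_2^2+\lambda_b\big\|(\mathbb{W}^2_n)^{\frac12}\mathbb{D}^2_n\theta\big\|_2^2$$ with tuning parameter $\lambda_b\ge3\lambda_a$, then $$\big\|\hat f(x_{1:n})-\hat\theta\big\|_2^2\le\frac{\lambda_b}{3}\int_a^b(D^2\hat f)(x)^2\,dx.$$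
   Context: Here $n\ge3$ and $f(x_{1:n})=(f(x_1),\ldots,f(x_n))$. Spectral similarity: positive semidefinite matrices $\mathbb{A},\mathbb{B}\in\mathbb{R}^{N\times N}$ are $(\sigma,\tau)$-spectrally-similar, for $0<\tau\le1\le\sigma$, if $\tau u^{\mathsf T}\mathbb{B}u\le u^{\mathsf T}\mathbb{A}u\le\sigma u^{\mathsf T}\mathbb{B}u$ for all $u\in\mathbb{R}^N$. The matrix $\mathbb{K}^2_n$: its inverse is the symmetric tridiagonal matrix with diagonal entries $(\mathbb{K}^2_n)^{-1}_{ii}=\frac{4}{3(x_{i+2}-x_i)}$, $i=1,\ldots,n-2$, and off-diagonal entries $(\mathbb{K}^2_n)^{-1}_{i,i-1}=(\mathbb{K}^2_n)^{-1}_{i-1,i}=\frac{2(x_{i+1}-x_i)}{3(x_{i+2}-x_i)(x_{i+1}-x_{i-1})}$, $i=2,\ldots,n-2$. (For every natural cubic spline $f$ on $[a,b]$ with knots $x_{1:n}$ one has the classical identity $\int_a^b(D^2f)(x)^2dx=\|(\mathbb{K}^2_n)^{1/2}\mathbb{D}^2_nf(x_{1:n})\|_2^2$.) $\mathbb{D}^2_n\in\mathbb{R}^{(n-2)\times n}$ is the second order discrete derivative matrix: $(\mathbb{D}^2_n\theta)_i=\frac{2}{x_{i+2}-x_i}\Big(\frac{\theta_{i+2}-\theta_{i+1}}{x_{i+2}-x_{i+1}}-\frac{\theta_{i+1}-\theta_i}{x_{i+1}-x_i}\Big)$, $i=1,\ldots,n-2$. The smoothing spline problem is minimized over all functions $f$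 on $[a,b]$ that are twice weakly differentiable with $\int_a^b(D^2f)(x)^2dx<\infty$. *)

(* Defs.v *)
From mathcomp Require Import all_boot all_order all_algebra.
From mathcomp Require Import all_classical all_reals all_analysis.
From mathcomp Require Import ring.
Set Implicit Arguments.
Unset Strict Implicit.
Unset Printing Implicit Defensive.
Import Order.TTheory GRing.Theory Num.Theory.
Import numFieldNormedType.Exports.
Local Open Scope classical_set_scope.
Local Open Scope ring_scope.

Definition quadform {R : realType} {N : nat} (A : 'M[R]_N) (u : 'cV[R]_N) : R :=
  (u^T *m A *m u) 0 0.

Definition psdmx {R : realType} {N : nat} (A : 'M[R]_N) : Prop :=
  A^T = A /\ forall u : 'cV[R]_N, 0 <= quadform A u.

Definition spectrally_similar {R : realType} {N : nat}
    (sigma tau : R) (A B : 'M[R]_N) : Prop :=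
  [/\ psdmx A, psdmx B, 0 < tau, tau <= 1 <= sigma &
      forall u : 'cV[R]_N,
        tau * quadform B u <= quadform A u <= sigma * quadform B u].

(* The library norm on matrices is the sup norm. *)
Definition sqnorm2 {R : realType} {N : nat} (v : 'cV[R]_N) : R :=
  \sum_i v i 0 ^+ 2.

Lemma knot_subproof n k (i : 'I_(n - 2)) : (k <= 2)%N -> (i + k < n)%N.
Proof.
move=> k2; have := ltn_ord i; rewrite ltn_subRL addnC.
by apply: leq_ltn_trans; rewrite leq_add2l.
Qed.

(* knot0, knot1, knot2 send i : 'I_(n - 2) to i, i + 1, i + 2 in 'I_n.
   Indices start at 0. *)
Definition knot0 {n} (i : 'I_(n - 2)) : 'I_n :=
  Ordinal (knot_subproof i (isT : (0 <= 2)%N)).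
Definition knot1 {n} (i : 'I_(n - 2)) : 'I_n :=
  Ordinal (knot_subproof i (isT : (1 <= 2)%N)).
Definition knot2 {n} (i : 'I_(n - 2)) : 'I_n :=
  Ordinal (knot_subproof i (isT : (2 <= 2)%N)).

Section Matrices.
Context {R : realType} {n : nat} (x : 'I_n -> R).

Definition D2mx : 'M[R]_(n - 2, n) := \matrix_(i, k)
  (2 / (x (knot2 i) - x (knot0 i)) *
   (((k == knot2 i)%:R - (k == knot1 i)%:R) / (x (knot2 i) - x (knot1 i)) -
    ((k == knot1 i)%:R - (k == knot0 i)%:R) / (x (knot1 i) - x (knot0 i)))).

Lemma D2mxE (theta : 'cV[R]_n) (i : 'I_(n - 2)) :
  (D2mx *m theta) i 0 =
  2 / (x (knot2 i) - x (knot0 i)) *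
  ((theta (knot2 i) 0 - theta (knot1 i) 0) / (x (knot2 i) - x (knot1 i)) -
   (theta (knot1 i) 0 - theta (knot0 i) 0) / (x (knot1 i) - x (knot0 i))).
Proof.
have sum_delta (k : 'I_n) : \sum_j (j == k)%:R * theta j 0 = theta k 0.
  rewrite (bigD1 k) //= eqxx mul1r big1 ?addr0 // => j /negbTE ->.
  by rewrite mul0r.
rewrite -!sum_delta -!sumrB !mulr_suml -sumrB mulr_sumr mxE.
by apply: eq_bigr => j _; rewrite mxE; ring.
Qed.

Definition W2mx : 'M[R]_(n - 2) :=
  diag_mx (\row_i ((x (knot2 i) - x (knot0 i)) / 2)).

(* W2mx is diagonal, so its square root is taken entrywise. *)
Definition sqrtW2mx : 'M[R]_(n - 2) := map_mx Num.sqrt W2mx.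

(* The (i, j) entry of K2inv in the case j = i - 1. *)
Definition K2inv_offdiag (i j : 'I_(n - 2)) : R :=
  (2 * (x (knot1 i) - x (knot0 i))) /
  (3 * (x (knot2 i) - x (knot0 i)) * (x (knot1 i) - x (knot0 j))).

Definition K2inv : 'M[R]_(n - 2) := \matrix_(i, j)
  if i == j then 4 / (3 * (x (knot2 i) - x (knot0 i)))
  else if i == j.+1 :> nat then K2inv_offdiag i j
  else if j == i.+1 :> nat then K2inv_offdiag j i
  else 0.

(* For increasing x, K2inv is invertible: the rows of K2inv *m W2mx have
   diagonal entry 2/3 and nonnegative off-diagonal entries of sum at most 1/3. *)
Definition K2mx : 'M[R]_(n - 2) := invmx K2inv.

End Matrices.

Section WeakDerivatives.
Context {R : realType}.
Local Notation mu := (@lebesgue_measure R).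

Definition smooth (phi : R -> R) : Prop :=
  forall (k : nat) (t : R), derivable (derive1n k phi) t 1.

Definition test_function (a b : R) (phi : R -> R) : Prop :=
  [/\ smooth phi, compact (closure [set t | phi t != 0]) &
      closure [set t | phi t != 0] `<=` `]a, b[].

Definition is_weak_derivative (a b : R) (f g : R -> R) : Prop :=
  [/\ locally_integrable `]a, b[ f, locally_integrable `]a, b[ g &
      forall phi, test_function a b phi ->
        \int[mu]_(t in `]a, b[) (f t * (phi^`())%classic t) =
        - \int[mu]_(t in `]a, b[) (g t * phi t)].

Definition weakly_differentiable (a b : R) (f : R -> R) : Prop :=
  exists g, is_weak_derivative a b f g.

(* A representative of the a.e. class of weak derivatives; the junk value is 0
   if f is not weakly differentiable. *)
Definition weak_derivative (a b : R) (f : R -> R) : R -> R :=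
  xget (fun=> 0) [set g | is_weak_derivative a b f g].

Definition weak_D2 (a b : R) (f : R -> R) : R -> R :=
  weak_derivative a b (weak_derivative a b f).

Definition roughness (a b : R) (f : R -> R) : R :=
  \int[mu]_(t in `[a, b]) (weak_D2 a b f t ^+ 2).

(* Functions on [a, b] are total functions of which only the restriction to
   [a, b] matters. A twice weakly differentiable function is evaluated at points,
   endpoints included, through its continuous representative. *)
Definition spline_space (a b : R) (f : R -> R) : Prop :=
  [/\ {within `[a, b], continuous f},
      weakly_differentiable a b f,
      weakly_differentiable a b (weak_derivative a b f) &
      (\int[mu]_(t in `[a, b]) ((weak_D2 a b f t) ^+ 2)%:E < +oo)%E].

End WeakDerivatives.

Section Problems.
Context {R : realType} {n : nat}.

Definition spline_objective (a b : R) (x : 'I_n -> R) (y : 'cV[R]_n)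
    (lambda : R) (f : R -> R) : R :=
  \sum_i (y i 0 - f (x i)) ^+ 2 + lambda * roughness a b f.

Definition spline_solution (a b : R) (x : 'I_n -> R) (y : 'cV[R]_n)
    (lambda : R) (fhat : R -> R) : Prop :=
  spline_space a b fhat /\
  forall f, spline_space a b f ->
    spline_objective a b x y lambda fhat <= spline_objective a b x y lambda f.

Definition BW_objective (x : 'I_n -> R) (y : 'cV[R]_n) (lambda : R)
    (theta : 'cV[R]_n) : R :=
  sqnorm2 (y - theta) + lambda * sqnorm2 (sqrtW2mx x *m (D2mx x *m theta)).

Definition BW_solution (x : 'I_n -> R) (y : 'cV[R]_n) (lambda : R)
    (thetahat : 'cV[R]_n) : Prop :=
  forall theta, BW_objective x y lambda thetahat <= BW_objective x y lambda theta.

End Problems.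

(* Main.v *)
Require Import Defs.
From mathcomp Require Import all_boot all_order all_algebra.
From mathcomp Require Import all_classical all_reals all_analysis.
From mathcomp Require Import ring lra zify.
Import Order.TTheory GRing.Theory Num.Theory.
Import numFieldNormedType.Exports measurable_realfun.
Local Open Scope classical_set_scope.
Local Open Scope ring_scope.

(** Write [w_i = (x_(i+2) - x_i) / 2], [D] for the second order discrete
derivative, and [|e|_W^2] for the sum of the [w_i * e_i^2]. Both penalties are
quadratic in [D theta], they differ by a factor of at most 3, and the distance
between the two minimisers is read off their first order conditions.

Spectral part. The inverse of [K] has nonnegative entries; weighting its
columns by [w] makes every diagonal entry 2/3 and every off-diagonal row sum at
most 1/3 ([K2inv_offdiag_sum]). Hence [W^-1 / 3 <= K^-1 <= W^-1] as quadratic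
forms ([diag_dominant_quadform]), and inverting the three matrices gives
[W <= K <= 3 W] ([invmx_spectrally_similar]).

Analytic part. The comparison needs two facts on functions: every [f] of the
spline space satisfies [|D f(x)|_W^2 <= int f''^2] ([roughness_lower_bound]),
and every vector [theta] is interpolated by some [g] of the spline space with
[int g''^2 <= 3 |D theta|_W^2] ([spline_interpolant]). Both come from Peano's
identity ([peano_kernel]): if the weights [al] annihilate affine functions, then
the integral of [f''(t) * sum_k al_k (t - x_k)_+] is [sum_k al_k f(x_k)]. For
the weights of [D] the kernel is a combination of hat functions. Testing [f'']
against such a combination gives the lower bound; taking a combination of hats
as second derivative, that is a natural cubic spline, gives the interpolant.
The Gram matrix of the hats is needed for both. It is found without computing an
integral: Peano's identity applied to a natural spline turns it into second
differences of truncated cubes, which are evaluated case by case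
([K2inv_second_difference]) and produce exactly the entries of [K^-1].

Second derivatives are only known through smooth test functions. Peano's
identity is therefore proved for kernels in which [(t - x_k)_+] is replaced by a
smooth ramp starting at a point slightly inside [a, b]; its second derivative is
an approximate identity, and the limit is taken on both sides. Perturbing the
smoothing spline and computing the roughness of an explicit spline also require
that a weak second derivative is unique almost everywhere
([weak_second_derivative_unique]): the smooth bumps
[exp (- 1 / (m (t - c)) - 1 / (m (d - t)))] tend to the indicator of ]c, d[ as
[m] grows, so a function orthogonal to all test functions has zero integral on
every interval, and it vanishes by Lebesgue differentiation
([test_orthogonal_ae0]).

Conclusion. Let [ta] be the values of the smoothing spline at the knots, [tb]
the minimiser of the filtering problem, [d = ta - tb], and [g] an interpolant of
[tb] as above. Optimality of [tb] in the direction [d] gives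
[<y - tb, d> <= lb (<D tb, D ta>_W - |D tb|_W^2)]. Moving the smoothing
spline towards [g] gives [- <y - ta, d> <= la / 4 * int g''^2], which is at most
[lb / 4 * |D tb|_W^2] because [3 la <= lb]. Adding the two bounds [|d|^2], and
[<D tb, D ta>_W <= 3/4 |D tb|_W^2 + 1/3 |D ta|_W^2] removes all terms in [tb];
what remains is [lb / 3 * |D ta|_W^2], at most [lb / 3] times the roughness of
the smoothing spline. *)

(** * Smooth functions on the line *)

Section SmoothFunctions.
Context {R : realType}.
Implicit Types f g : R -> R.

(** Differentiability to order [n], with the derivative given as a witness:
    closure under algebraic operations becomes an induction on [n] in which no
    derivative has to be computed by rewriting under [derive1]. *)
Fixpoint diffn n f : Prop :=
  if n is m.+1 then
    exists2 g, (forall t, is_derive t (1 : R) f (g t)) & diffn m g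
  else True.

Lemma is_derive_derive1 f g :
  (forall t, is_derive t (1 : R) f (g t)) -> (f^`())%classic = g.
Proof. by move=> fg; apply/funext => t; rewrite derive1E derive_val. Qed.

Lemma is_derive_mul f g (t df dg : R) :
  is_derive t (1 : R) f df -> is_derive t (1 : R) g dg ->
  is_derive t (1 : R) (fun u => f u * g u) (f t * dg + g t * df).
Proof. by move=> ff gg; exact: (is_deriveM ff gg). Qed.

Lemma is_derive_add f g (t df dg : R) :
  is_derive t (1 : R) f df -> is_derive t (1 : R) g dg ->
  is_derive t (1 : R) (fun u => f u + g u) (df + dg).
Proof. by move=> ff gg; exact: (is_deriveD ff gg). Qed.

Lemma is_derive_scale f (c t df : R) : is_derive t (1 : R) f df ->
  is_derive t (1 : R) (fun u => c * f u) (c * df).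
Proof. by move=> ff; exact: (is_deriveZ c ff). Qed.

Lemma smoothP f : smooth f <-> forall n, diffn n f.
Proof.
split=> [sf n|cf k].
  elim: n f sf => //= n IHn f sf; exists (f^`())%classic.
    move=> t; have := sf 0%N t; rewrite derive1n0 => /derivableP.
    by rewrite derive1E.
  by apply: IHn => k t; rewrite -derive1Sn; exact: sf.
elim: k f cf => [|k IHk] f cf t.
  by have [g fg _] := cf 1%N; have [] := fg t.
rewrite derive1Sn; apply: IHk => n; have [g fg cg] := cf n.+1.
by rewrite (is_derive_derive1 _ _ fg).
Qed.

Lemma smooth_derive1 f : smooth f -> smooth (f^`())%classic.
Proof. by move=> sf k t; rewrite -derive1Sn; exact: sf. Qed.

Lemma smooth_is_derive f : smooth f ->
  forall t, is_derive t (1 : R) f ((f^`())%classic t).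
Proof. by move=> sf t; rewrite derive1E; apply/derivableP/(sf 0%N). Qed.

Lemma diffnS n f : diffn n.+1 f -> diffn n f.
Proof. by elim: n f => //= n IHn f [g fg cg]; exists g => //; exact: IHn. Qed.

Lemma diffn_cst n (c : R) : diffn n (fun=> c).
Proof.
elim: n c => //= n IHn c; exists (fun=> 0) => // t; exact: is_derive_cst.
Qed.

Lemma diffn_id n : diffn n (fun t : R => t).
Proof.
case: n => //= n; exists (fun=> 1); last exact: diffn_cst.
by move=> t; exact: is_derive_id.
Qed.

Lemma diffnD n f g : diffn n f -> diffn n g -> diffn n (fun t => f t + g t).
Proof.
elim: n f g => //= n IHn f g [f' ff' cf'] [g' gg' cg'].
exists (fun t => f' t + g' t); last exact: IHn.
by move=> t; exact: is_derive_add.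
Qed.

(** By Leibniz's rule the derivative of a product is a sum of products of
    functions that are differentiable to one order less. *)
Lemma diffnM n f g : diffn n f -> diffn n g -> diffn n (fun t => f t * g t).
Proof.
elim: n f g => //= n IHn f g cf cg.
have [f' ff' cf'] := cf; have [g' gg' cg'] := cg.
exists (fun t => f t * g' t + g t * f' t); last first.
  by apply: diffnD; apply: IHn => //; exact: diffnS.
by move=> t; exact: is_derive_mul.
Qed.

Lemma diffnV n f : (forall t, f t != 0) -> diffn n f ->
  diffn n (fun t => (f t)^-1).
Proof.
move=> f0; elim: n => //= n IHn cf; have [f' ff' cf'] := cf.
exists (fun t => (- 1) * f' t * ((f t)^-1 * (f t)^-1)); last first.
  have cV : diffn n (fun t => (f t)^-1) by apply: IHn; exact: diffnS.
  by apply: diffnM; apply: diffnM => //; exact: diffn_cst.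
move=> t; have [df dfE] := ff' t.
apply: DeriveDef; first exact: derivableV (f0 t) df.
rewrite deriveV// dfE /GRing.scale/= -exprVn; ring.
Qed.

Lemma is_derive_affine (s c t : R) :
  is_derive t (1 : R) (fun u => s * u + c) s.
Proof.
have -> : (fun u : R => s * u + c) = (s \*: (@id R) : R -> R) \+ cst c by [].
by apply: is_derive_eq; rewrite addr0 /GRing.scale/= mulr1.
Qed.

Lemma is_derive_comp_affine f (df s c t : R) :
  is_derive (s * t + c) (1 : R) f df ->
  is_derive t (1 : R) (fun u => f (s * u + c)) (s * df).
Proof.
move=> fd; rewrite mulrC; have ad := is_derive_affine s c t.
exact: (@is_derive1_comp _ f (fun u => s * u + c)).
Qed.

Lemma diffn_comp_affine n f (s c : R) :
  diffn n f -> diffn n (fun t => f (s * t + c)).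
Proof.
elim: n f => //= n IHn f [g fg cg].
exists (fun t => s * g (s * t + c)).
  by move=> t; exact: is_derive_comp_affine.
by apply: diffnM; [exact: diffn_cst|exact: IHn].
Qed.

(** For [m = 0] this is the classical flat function exp(-1/t). The negative
    powers of [t] make the family stable under differentiation, up to linear
    combinations. *)
Definition flat (m : nat) (t : R) : R :=
  if 0 < t then t ^- m * expR (- t^-1) else 0.

(** With [u = 1/t] this is the inequality between [u ^ m / m!] and
    exp u. *)
Lemma flat_bounded m (t : R) : 0 <= flat m t <= m.+1`!%:R.
Proof.
rewrite /flat; case: ltrP => t0; last by rewrite lexx ler0n.
have u0 : 0 <= t^-1 by rewrite invr_ge0 ltW.
rewrite mulr_ge0 ?expR_ge0//=; last by rewrite -exprVn exprn_ge0.
rewrite expRN ler_pdivrMr ?expR_gt0// -exprVn.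
move: (t^-1) u0 => u u0.
have fge1 k : (1 : R) <= k`!%:R by rewrite ler1n fact_gt0.
case: m => [|m].
  have := expR_ge1Dx u; rewrite expr0 (_ : 1`! = 1)%N// mul1r; lra.
have h : u ^+ m.+1 / m.+1`!%:R <= expR u.
  by have := expR_ge1Dxn m u0; lra.
move: h; rewrite ler_pdivrMr; last by have := fge1 m.+1; lra.
rewrite mulrC => /le_trans; apply; apply: ler_wpM2r; first exact: expR_ge0.
by rewrite ler_nat factS leq_pmull.
Qed.

(** [flat m t = t * flat m.+1 t], and [flat m.+1] is bounded. *)
Lemma flat_le_linear m (t : R) : `|flat m t| <= m.+2`!%:R * `|t|.
Proof.
have -> : flat m t = t * flat m.+1 t.
  rewrite /flat; case: ltrP => t0; last by rewrite mulr0.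
  by rewrite mulrA exprS invfM mulrA divff ?gt_eqF// mul1r.
rewrite normrM mulrC; apply: ler_wpM2r => //.
by have /andP[f0 f1] := flat_bounded m.+1 t; rewrite ger0_norm.
Qed.

(** Away from 0 this is the chain rule. At 0 the difference quotient of
    [flat m] equals [flat m.+1], which tends to 0 there. *)
Lemma flat_derive m (t : R) :
  is_derive t (1 : R) (flat m) (flat m.+2 t - m%:R * flat m.+1 t).
Proof.
have [t0|t0|->] := ltrgtP t 0.
- rewrite /flat ltNge ltW//= mulr0 subrr.
  have : is_derive t (1 : R) (cst (0 : R)) 0 by exact: is_derive_cst.
  apply: near_eq_is_derive; near=> u; rewrite /= ltNge.
  by have -> : u <= 0; first by near: u; exact: lt_le_nbhsl.
- have tn0 : t != 0 by rewrite gt_eqF.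
  have : is_derive t (1 : R) (fun u => u ^- m * expR (- u^-1))
      (flat m.+2 t - m%:R * flat m.+1 t).
    have d1 : is_derive t (1 : R) (fun u : R => u ^- m)
        (- (t ^+ m) ^- 2 * (m%:R * t ^+ m.-1)).
      apply: DeriveDef.
        by apply: derivableV; [rewrite expf_neq0|exact: exprn_derivable].
      rewrite deriveV ?expf_neq0//; last exact: exprn_derivable.
      by rewrite exp_derive /GRing.scale/= mulr1.
    have d2 : is_derive t (1 : R) (fun u : R => - u^-1) (t ^- 2).
      have -> : (fun u : R => - u^-1) = - (fun u => u^-1) by [].
      apply: DeriveDef; first by apply/derivableN/derivableV.
      rewrite deriveN; last exact: derivableV.
      rewrite deriveV// derive_id /GRing.scale/= mulr1; exact: opprK.
    have d3 : is_derive t (1 : R) (fun u : R => expR (- u^-1))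
        (expR (- t^-1) * t ^- 2).
      exact: (@is_derive1_comp _ expR (fun u => - u^-1)).
    have -> : flat m.+2 t - m%:R * flat m.+1 t =
        t ^- m * (expR (- t^-1) * t ^- 2) +
        expR (- t^-1) * (- (t ^+ m) ^- 2 * (m%:R * t ^+ m.-1)).
      rewrite /flat t0; case: m {d1} => [|m].
        by rewrite !mul0r expr0; field.
      by rewrite -pred_Sn !exprS; field; rewrite expf_neq0 ?tn0.
    exact: is_derive_mul.
  apply: near_eq_is_derive; near=> u; rewrite /flat.
  by have -> : 0 < u by near: u; exact: lt_nbhsr.
- rewrite [flat m.+2 0]/flat [flat m.+1 0]/flat ltxx mulr0 subrr.
  (* The difference quotient at 0 is [flat m.+1], at most linear in [h]. *)
  have q0 : (fun h : R => h^-1 *: (flat m (h *: 1 + 0) - flat m 0)) @ 0^' --> 0.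
    apply/cvgrPdist_le => /= e e0.
    near=> h; rewrite sub0r normrN.
    have h0 : h != 0 by near: h; exact: nbhs_dnbhs_neq.
    have -> : h^-1 *: (flat m (h *: 1 + 0) - flat m 0) = flat m.+1 h.
      rewrite addr0 {1 2}/GRing.scale/= mulr1 [flat m 0]/flat ltxx subr0 /flat.
      by case: ltrP => hp; rewrite ?mulr0// exprS invfM mulrA.
    apply: (le_trans (flat_le_linear _ _)).
    rewrite mulrC -ler_pdivlMr; last by rewrite ltr0n fact_gt0.
    near: h; apply: dnbhs0_le; rewrite divr_gt0// ltr0n fact_gt0//.
  by apply: DeriveDef; [apply/cvg_ex; exists 0|exact: cvg_lim q0].
Unshelve. all: by end_near. Qed.

Lemma diffn_flat n m : diffn n (flat m).
Proof.
elim: n m => //= n IHn m.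
exists (fun t => flat m.+2 t + (- m%:R) * flat m.+1 t).
  by move=> t; rewrite mulNr; exact: flat_derive.
by apply: diffnD => //; apply: diffnM => //; exact: diffn_cst.
Qed.

(** A smooth function that is 0 on the negative half line and 1 beyond 1. *)
Definition smooth_step (t : R) : R := flat 0 t / (flat 0 t + flat 0 (1 - t)).

Lemma flat0_gt0 (t : R) : (0 < flat 0 t) = (0 < t).
Proof.
by rewrite /flat expr0 invr1 mul1r; case: ifP; rewrite ?expR_gt0 ?ltxx.
Qed.

(** [t] and [1 - t] cannot both be nonpositive. *)
Lemma smooth_step_denom_gt0 (t : R) : 0 < flat 0 t + flat 0 (1 - t).
Proof.
have /andP[h1 _] := flat_bounded 0 t.
have /andP[h2 _] := flat_bounded 0 (1 - t).
have := flat0_gt0 t; have := flat0_gt0 (1 - t).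
by case: (ltrP 0 t) => [|?]; [lra|]; have -> : 0 < 1 - t; lra.
Qed.

Lemma smooth_step0 (t : R) : t <= 0 -> smooth_step t = 0.
Proof. by move=> t0; rewrite /smooth_step {1}/flat ltNge t0 mul0r. Qed.

Lemma smooth_step1 (t : R) : 1 <= t -> smooth_step t = 1.
Proof.
move=> t1; have := smooth_step_denom_gt0 t; rewrite /smooth_step.
have -> : flat 0 (1 - t) = 0 by rewrite /flat ltNge subr_le0 t1.
by rewrite addr0 => h; rewrite divff// gt_eqF.
Qed.

Lemma smooth_step_ge0_le1 (t : R) : 0 <= smooth_step t <= 1.
Proof.
have d0 := smooth_step_denom_gt0 t; rewrite /smooth_step.
have /andP[h1 _] := flat_bounded 0 t.
have /andP[h2 _] := flat_bounded 0 (1 - t).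
by rewrite divr_ge0 ?(ltW d0)//= ler_pdivrMr// mul1r lerDl.
Qed.

Lemma diffn_smooth_step n : diffn n smooth_step.
Proof.
apply: diffnM; first exact: diffn_flat.
apply: diffnV; first by move=> t; rewrite gt_eqF// smooth_step_denom_gt0.
apply: diffnD; first exact: diffn_flat.
have -> : (fun t : R => flat 0 (1 - t)) = (fun t => flat 0 ((-1) * t + 1)).
  by apply/funext => t; rewrite mulN1r addrC.
by apply: diffn_comp_affine; exact: diffn_flat.
Qed.

End SmoothFunctions.

(** * Test functions and the fundamental lemma *)

Section TestFunctions.
Context {R : realType}.
Local Notation mu := (@lebesgue_measure R).
Implicit Types (a b c d : R) (f k phi : R -> R).

Lemma smooth_continuous phi : smooth phi -> continuous phi.
Proof.
move=> sphi t; apply/differentiable_continuous/derivable1_diffP.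
exact: (sphi 0%N t).
Qed.

Lemma test_function_itv a b c d phi : a < c -> d < b ->
  smooth phi -> (forall t, phi t != 0 -> c <= t <= d) -> test_function a b phi.
Proof.
move=> ac db sphi supp.
have sub : closure [set t | phi t != 0] `<=` `[c, d].
  rewrite [X in _ `<=` X](iffLR (closure_id _)); last exact: itv_closed.
  by apply: closureS => t /= /supp; rewrite in_itv.
split=> //.
  apply: subclosed_compact sub; first exact: closed_closure.
  exact: segment_compact.
move=> t /sub /=; rewrite !in_itv/= => /andP[ct td].
by rewrite (lt_le_trans ac ct) (le_lt_trans td db).
Qed.

(** Off the closed support of [phi], the function is locally zero, and
    so is its derivative. *)
Lemma test_function_derive1 a b phi :
  test_function a b phi -> test_function a b (phi^`())%classic.
Proof.
move=> [sphi cphi sub].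
have clsub : closure [set t | (phi^`())%classic t != 0] `<=`
    closure [set t | phi t != 0].
  rewrite [X in _ `<=` X](iffLR (closure_id _)); last exact: closed_closure.
  apply: closureS => t /= /eqP dt; apply: contrapT => tphi; apply: dt.
  have nt : \forall u \near t, phi u = 0.
    have : open (~` closure [set t | phi t != 0]).
      by apply: closed_openC; exact: closed_closure.
    rewrite openE => /(_ _ tphi); apply: filterS => u /= uphi.
    apply/eqP/negPn/negP => up; apply: uphi; exact: subset_closure.
  rewrite derive1E (@near_eq_derive _ _ _ phi (cst 0))//.
  by rewrite derive_cst.
split; first exact: smooth_derive1.
- by apply: subclosed_compact clsub => //; exact: closed_closure.
- exact: subset_trans sub.
Qed.

(** The product vanishes off a compact subset of ]a, b[, on which [f] is
    integrable and [phi] is bounded. *)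
Lemma integrable_mul_test a b f phi :
  locally_integrable `]a, b[ f -> test_function a b phi ->
  mu.-integrable `]a, b[ (EFin \o (fun t => f t * phi t)).
Proof.
move=> [mf _ intf] [sphi cphi sub].
set K := closure _ in cphi sub.
have mK : measurable K by exact: compact_measurable.
have cp := smooth_continuous _ sphi.
have intK : mu.-integrable K (EFin \o (fun t => f t * phi t)).
  have -> : EFin \o (fun t => f t * phi t) =
      ((EFin \o f) \* (EFin \o phi))%E by apply/funext => t; rewrite /= EFinM.
  apply: integrableMl => //.
  - apply/integrableP; split; last exact: intf.
    by apply/measurable_EFinP; apply: measurable_funS mf.
  - exact: measurable_funS (continuous_measurable_fun cp).
  - have cw : {within K, continuous phi} by exact: continuous_subspaceT.
    have /compact_bounded[M [_ mrt]] := continuous_compact cw cphi.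
    by exists M; split; rewrite ?num_real // => ? ? ? ?; exact: mrt.
have -> : EFin \o (fun t => f t * phi t) =
    (EFin \o (fun t => f t * phi t)) \_ K.
  apply/funext => t; rewrite /= patchE; case: ifPn => // /negP tK.
  suff -> : phi t = 0 by rewrite mulr0.
  apply/eqP/negPn/negP => pt; apply: tK; rewrite inE; exact: subset_closure.
by apply/integrable_restrict => //; rewrite setIidr.
Qed.

Lemma flat0_le1 (t : R) : 0 <= flat 0 t <= 1.
Proof. exact: flat_bounded 0 t. Qed.

Lemma flat0_cvg1 (s : R) : 0 < s ->
  flat 0 (n.+1%:R * s) @[n --> \oo] --> (1 : R).
Proof.
move=> s0; rewrite [X in X @ _](_ : _ =
    expR \o (fun n => - s^-1 * (n.+1%:R)^-1)); last first.
  apply/funext => n; rewrite /flat mulr_gt0// ?ltr0n//= expr0 invr1 mul1r.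
  by rewrite invfM mulNr mulrC.
rewrite -[X in _ --> X](@expR0 R).
apply: continuous_cvg; first exact: continuous_expR.
rewrite -[X in _ --> X](mulr0 (- s^-1)).
by apply: cvgM; [exact: cvg_cst|exact: cvg_harmonic].
Qed.

(** A sequence of test functions that are bounded by 1 and tend pointwise to the
    indicator of ]c, d[: scaling the argument of exp(-1/t) by a large factor
    brings every positive value close to 1. *)
Definition bump c d n (t : R) : R :=
  flat 0 (n.+1%:R * (t - c)) * flat 0 (n.+1%:R * (d - t)).

Lemma smooth_bump c d n : smooth (bump c d n).
Proof.
apply/smoothP => m; apply: diffnM.
  have := diffn_comp_affine m (flat 0) n.+1%:R (- n.+1%:R * c) (diffn_flat m 0).
  congr (diffn m _); apply/funext => t; congr flat; ring.
have := diffn_comp_affine m (flat 0) (- n.+1%:R) (n.+1%:R * d) (diffn_flat m 0).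
congr (diffn m _); apply/funext => t; congr flat; ring.
Qed.

Lemma bump_neq0 c d n t : bump c d n t != 0 -> c < t < d.
Proof.
apply: contraNT => /nandP[]; rewrite -leNgt => h; rewrite /bump.
  by rewrite {1}/flat ltNge pmulr_rle0 ?ltr0n// subr_le0 h mul0r.
by rewrite mulrC {1}/flat ltNge pmulr_rle0 ?ltr0n// subr_le0 h mul0r.
Qed.

Lemma test_bump a b c d n : a < c -> d < b -> test_function a b (bump c d n).
Proof.
move=> ac db; apply: (test_function_itv a b c d) => //.
  exact: smooth_bump.
by move=> t /bump_neq0/andP[? ?]; rewrite !ltW.
Qed.

Lemma bump_cvg1 c d t : c < t < d -> bump c d n t @[n --> \oo] --> (1 : R).
Proof.
move=> /andP[ct td]; rewrite -[X in _ --> X]mulr1.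
by apply: cvgM; apply: flat0_cvg1; rewrite subr_gt0.
Qed.

(** Dominated convergence along the bumps of ]c, d[, with dominating
    function [|k|]. *)
Lemma test_orthogonal_integral0 a b k c d : locally_integrable `]a, b[ k ->
  (forall phi, test_function a b phi ->
    \int[mu]_(t in `]a, b[) (k t * phi t) = 0) ->
  a < c -> d < b -> \int[mu]_(t in `]c, d[) k t = 0.
Proof.
move=> lk k0 ac db.
have sub : [set` `]c, d[] `<=` [set` `]a, b[].
  by apply: subset_itvW; exact: ltW.
have subK : [set` `]c, d[] `<=` [set` `[c, d]] by exact: subset_itv_oo_cc.
have ik : mu.-integrable `]c, d[ (EFin \o k).
  apply: (@integrableS _ _ _ mu `[c, d]) => //.
  case: lk => mk _ ik.
  have cdab : [set` `[c, d]] `<=` [set` `]a, b[].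
    move=> t /=; rewrite !in_itv/= => /andP[ct td].
    by rewrite (lt_le_trans ac ct) (le_lt_trans td db).
  apply/integrableP; split; last first.
    by apply: ik => //; exact: segment_compact.
  by apply/measurable_EFinP; apply: measurable_funS mk.
have mk : measurable_fun `]c, d[ k.
  by apply/measurable_EFinP; exact: measurable_int ik.
have z n : (\int[mu]_(t in `]c, d[) (k t * bump c d n t)%:E = 0)%E.
  have := k0 _ (test_bump a b c d n ac db).
  have := integrable_mul_test _ _ _ _ lk (test_bump a b c d n ac db).
  rewrite /Rintegral => it k00.
  have fn : (\int[mu]_(t in `]a, b[) (k t * bump c d n t)%:E)%E \is a fin_num.
    by apply: integrable_fin_num it; exact: measurable_itv.
  transitivity (\int[mu]_(t in `]a, b[) (k t * bump c d n t)%:E)%E; last first.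
    by rewrite -(fineK fn) k00.
  rewrite integral_mkcond [RHS]integral_mkcond; apply: eq_integral => t _.
  rewrite !patchE; case: ifPn => tcd.
    by rewrite ifT// inE; apply: sub; rewrite -inE.
  case: ifPn => // _.
  suff -> : bump c d n t = 0 by rewrite mulr0.
  apply/eqP/negPn/negP => /bump_neq0 => tt.
  by move: tcd; rewrite notin_setE/= in_itv/= tt.
have [] := @dominated_convergence _ _ _ mu `]c, d[ (measurable_itv _)
  (fun n t => (k t * bump c d n t)%:E) (EFin \o k) (fun t => `|k t|%:E).
- move=> n; apply/measurable_EFinP; apply: measurable_funM => //.
  apply: measurable_funTS; apply: continuous_measurable_fun.
  exact/smooth_continuous/smooth_bump.
- exact: measurable_int ik.
- apply: aeW => t /=; rewrite in_itv/= => ctd.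
  have h : k t * bump c d n t @[n --> \oo] --> k t * 1.
    by apply: cvgM; [exact: cvg_cst|exact: bump_cvg1].
  by rewrite mulr1 in h; apply: cvg_EFin; [exact: nearW|exact: h].
- exact: integrable_norm ik.
- apply: aeW => t n _; rewrite lee_fin normrM ler_piMr//.
  have /andP[h1 h2] := flat0_le1 (n.+1%:R * (t - c)).
  have /andP[h3 h4] := flat0_le1 (n.+1%:R * (d - t)).
  by rewrite ger0_norm ?mulr_ge0// mulr_ile1.
move=> _ _; rewrite /= (_ : (fun n => _) = fun=> 0%E); last exact/funext.
move=> /cvg_lim; rewrite lim_cst// => /(_ (@ereal_hausdorff R)) h.
by rewrite /Rintegral -h.
Qed.

(** The fundamental lemma of the calculus of variations. All integrals of
    [k] over intervals vanish, so its indefinite integral is constant, and the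
    derivative of the latter is almost everywhere [k]. *)
Lemma test_orthogonal_ae0 a b k : locally_integrable `]a, b[ k ->
  (forall phi, test_function a b phi ->
    \int[mu]_(t in `]a, b[) (k t * phi t) = 0) ->
  {ae mu, forall t, `]a, b[%classic t -> k t = 0}.
Proof.
move=> lk k0.
have cd0 c d : a < c -> d < b -> {ae mu, forall t, c < t < d -> k t = 0}.
  move=> ac db.
  have [cd|dc] := ltP c d; last first.
    by apply: aeW => t /andP[ct td]; have := lt_trans ct td; rewrite ltNge dc.
  have cdab : [set` `[c, d]] `<=` [set` `]a, b[].
    move=> t /=; rewrite !in_itv/= => /andP[ct td].
    by rewrite (lt_le_trans ac ct) (le_lt_trans td db).
  have ik : mu.-integrable `[c, d] (EFin \o k).
    case: lk => mk _ ik.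
    apply/integrableP; split; last first.
      by apply: ik => //; exact: segment_compact.
    by apply/measurable_EFinP; apply: measurable_funS mk.
  have ikT : mu.-integrable setT (EFin \o (k \_ `[c, d])).
    by rewrite -restrict_EFin; apply/integrable_restrict; rewrite ?setTI.
  have ltk : locally_integrable setT (k \_ `[c, d]).
    exact: integrable_locally.
  have iy y : mu.-integrable [set` `[c, y]] (EFin \o (k \_ `[c, d])).
    by apply: integrableS ikT => //; exact: measurable_itv.
  have := @FTC1 R (k \_ `[c, d]) (BLeft c) iy ltk.
  apply: filterS; first exact: (ae_filter_ringOfSetsType mu).
  move=> t /= tF /andP[ct td].
  have [] := tF; first by rewrite lte_fin.
  move=> _; rewrite patchE mem_set/=; last by rewrite in_itv/= !ltW.
  move=> <-; rewrite derive1E (@near_eq_derive _ _ _ _ (cst 0)) ?derive_cst//.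
  near=> y.
  have cy : c < y by near: y; exact: lt_nbhsr.
  have yd : y < d by near: y; exact: lt_nbhsl.
  have /= <- := test_orthogonal_integral0 a b k c y lk k0 ac (lt_trans yd db).
  have iky : mu.-integrable `]c, y[ (EFin \o k).
    apply: integrableS ik => // u /=; rewrite !in_itv/= => /andP[? ?].
    by rewrite !ltW//; exact: lt_trans yd.
  rewrite /Rintegral -(@integral_itv_bndoo _ _ _ _ true false); last first.
    exact: (measurable_int mu).
  congr fine; apply: eq_integral => u; rewrite inE/= in_itv/= => /andP[cu uy].
  by rewrite patchE mem_set//= in_itv/= cu (le_trans uy (ltW yd)).
have : {ae mu, forall t (n : nat),
    a + n.+1%:R^-1 < t < b - n.+1%:R^-1 -> k t = 0}.
  apply: ae_foralln => n; apply: cd0; first by rewrite ltrDl.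
  by rewrite ltrBlDr ltrDl.
apply: filterS; first exact: (ae_filter_ringOfSetsType mu).
move=> t h /=; rewrite in_itv/= => /andP[at_ tb].
(* Some interval of the exhausting sequence contains [t]. *)
have m0 : 0 < Num.min (t - a) (b - t) by rewrite lt_min !subr_gt0 at_ tb.
have [n _ /(_ n (leqnn n))/= ] := near_infty_natSinv_lt (PosNum m0).
rewrite lt_min => /andP[h1 h2]; apply: (h n).
by rewrite -ltrBrDl h1 ltrBrDr -ltrBrDl h2.
Unshelve. all: by end_near. Qed.

End TestFunctions.

(** * Weak second derivatives *)

Section WeakSecondDerivative.
Context {R : realType}.
Local Notation mu := (@lebesgue_measure R).
Implicit Types (a b : R) (f g h k phi : R -> R).

(** Pairing directly with second derivatives of test functions leaves out
    the intermediate first derivative, which is only determined up to null sets. *)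
Definition weak_second_derivative a b f k : Prop :=
  locally_integrable `]a, b[ k /\
  forall phi, test_function a b phi ->
    \int[mu]_(t in `]a, b[) (f t * ((phi^`())^`())%classic t) =
    \int[mu]_(t in `]a, b[) (k t * phi t).

Lemma weak_derivativeP a b f : weakly_differentiable a b f ->
  is_weak_derivative a b f (weak_derivative a b f).
Proof. by move=> wf; exact: (xgetPex (fun=> 0) wf). Qed.

Lemma is_weak_derivative2 a b f g k :
  is_weak_derivative a b f g -> is_weak_derivative a b g k ->
  weak_second_derivative a b f k.
Proof.
move=> [lf lg fg] [_ lk gk]; split=> // phi tphi.
rewrite fg; last exact: test_function_derive1.
by rewrite gk// opprK.
Qed.

Lemma spline_weak_D2 a b f : spline_space a b f ->
  weak_second_derivative a b f (weak_D2 a b f).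
Proof.
by move=> [_ wf wwf _]; apply: is_weak_derivative2; exact: weak_derivativeP.
Qed.

Lemma weak_second_derivative_unique a b f k h :
  weak_second_derivative a b f k -> weak_second_derivative a b f h ->
  {ae mu, forall t, `]a, b[%classic t -> k t = h t}.
Proof.
move=> [lk fk] [lh fh].
have : {ae mu, forall t, `]a, b[%classic t -> k t - h t = 0}.
  apply: (@test_orthogonal_ae0 _ a b (fun t => k t - h t)).
    exact: locally_integrableB.
  move=> phi tphi; under eq_Rintegral do rewrite mulrBl.
  rewrite RintegralB//; [|exact: integrable_mul_test..].
  by rewrite -fk// -fh// subrr.
apply: filterS; first exact: (ae_filter_ringOfSetsType mu).
by move=> t /[apply] /eqP; rewrite subr_eq0 => /eqP.
Qed.

Lemma integral_sqr_unique a b f k h :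
  weak_second_derivative a b f k -> weak_second_derivative a b f h ->
  (\int[mu]_(t in `[a, b]) (k t ^+ 2)%:E =
   \int[mu]_(t in `[a, b]) (h t ^+ 2)%:E)%E.
Proof.
move=> wk wh; have [[mk _ _] _] := wk; have [[mh _ _] _] := wh.
have mk2 : measurable_fun `]a, b[ (fun t => (k t ^+ 2)%:E).
  by apply/measurable_EFinP; exact: measurable_funX.
have mh2 : measurable_fun `]a, b[ (fun t => (h t ^+ 2)%:E).
  by apply/measurable_EFinP; exact: measurable_funX.
rewrite integral_itv_bndoo// [RHS]integral_itv_bndoo//.
apply: ae_eq_integral => //.
have := weak_second_derivative_unique _ _ _ _ _ wk wh.
apply: filterS; first exact: (ae_filter_ringOfSetsType mu).
by move=> t /[apply] ->.
Qed.

Lemma roughnessE a b f k : spline_space a b f ->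
  weak_second_derivative a b f k ->
  roughness a b f = \int[mu]_(t in `[a, b]) (k t ^+ 2).
Proof.
move=> sf wk; rewrite /roughness /Rintegral.
by rewrite (integral_sqr_unique _ _ _ _ _ (spline_weak_D2 _ _ _ sf) wk).
Qed.

(** Membership can be checked with any weak second derivative [k]: [k] is a
    weak derivative of whichever first derivative has been chosen. *)
Lemma spline_spaceI a b f k : {within `[a, b], continuous f} ->
  weakly_differentiable a b f -> weak_second_derivative a b f k ->
  (\int[mu]_(t in `[a, b]) (k t ^+ 2)%:E < +oo)%E -> spline_space a b f.
Proof.
move=> cf wf wk k2; have [_ lw fw] := weak_derivativeP _ _ _ wf.
have ww : is_weak_derivative a b (weak_derivative a b f) k.
  split=> //; first by case: wk.
  move=> phi tphi; have [_ <-//] := wk.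
  by rewrite fw ?opprK//; exact: test_function_derive1.
have wwf : weakly_differentiable a b (weak_derivative a b f) by exists k.
split=> //.
suff -> : (\int[mu]_(t in `[a, b]) (weak_D2 a b f t ^+ 2)%:E =
           \int[mu]_(t in `[a, b]) (k t ^+ 2)%:E)%E by [].
apply: integral_sqr_unique wk.
by apply: is_weak_derivative2; exact: weak_derivativeP.
Qed.

Lemma integrable_sqr a b k : measurable_fun `]a, b[ k ->
  (\int[mu]_(t in `[a, b]) (k t ^+ 2)%:E < +oo)%E ->
  mu.-integrable `[a, b] (EFin \o (fun t => k t ^+ 2)).
Proof.
move=> mk k2; apply/integrableP; split.
  apply/measurable_EFinP; apply: (@measurable_fun_itv_cc _ a b false true).
  exact: measurable_funX.
by under eq_integral do rewrite /= ger0_norm ?sqr_ge0//.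
Qed.

Lemma weak_D2_measurable a b f : spline_space a b f ->
  measurable_fun `[a, b] (weak_D2 a b f).
Proof.
by move=> /spline_weak_D2[[mf _ _] _]; exact: measurable_fun_itv_cc mf.
Qed.

Lemma weak_D2_sqr_integrable a b f : spline_space a b f ->
  mu.-integrable `[a, b] (EFin \o (fun t => weak_D2 a b f t ^+ 2)).
Proof.
move=> sf; have [_ _ _ f2] := sf; apply: integrable_sqr => //.
by have [[]] := spline_weak_D2 _ _ _ sf.
Qed.

Lemma integrable_cst_itv a b (r : R) :
  mu.-integrable `[a, b] (EFin \o (fun=> r)).
Proof.
apply: continuous_compact_integrable; first exact: segment_compact.
by apply: continuous_subspaceT => t; exact: cvg_cst.
Qed.

(** On a bounded interval [|u| <= 1 + u^2] makes square integrable
    functions integrable. *)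
Lemma weak_D2_integrable a b f : spline_space a b f ->
  mu.-integrable `[a, b] (EFin \o weak_D2 a b f).
Proof.
move=> sf.
apply: (@le_integrable _ _ _ mu _ _ _
    (EFin \o (fun t => 1 + weak_D2 a b f t ^+ 2))).
- exact: measurable_itv.
- by apply/measurable_EFinP; exact: weak_D2_measurable.
- move=> t _; rewrite lee_fin [leRHS]ger0_norm; last first.
    by rewrite addr_ge0// sqr_ge0.
  rewrite -(real_normK (num_real (weak_D2 a b f t))).
  by have := sqr_ge0 (`|weak_D2 a b f t| - 1); nra.
- have -> : EFin \o (fun t => 1 + weak_D2 a b f t ^+ 2) =
      ((EFin \o (fun=> 1%R)) \+ (EFin \o (fun t => weak_D2 a b f t ^+ 2)%R))%E.
    by apply/funext => t; rewrite /= EFinD.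
  apply: integrableD => //.
    exact: integrable_cst_itv.
  exact: weak_D2_sqr_integrable.
Qed.

Lemma integrable_scale (D : set R) f (r : R) : measurable D ->
  mu.-integrable D (EFin \o f) -> mu.-integrable D (EFin \o (fun t => r * f t)).
Proof.
move=> mD jf; have -> : EFin \o (fun t => r * f t) =
    (fun t => r%:E * (EFin \o f) t)%E by apply/funext => t; rewrite /= EFinM.
exact: integrableZl.
Qed.

Lemma integrable_lincomb (D : set R) f g (r s : R) : measurable D ->
  mu.-integrable D (EFin \o f) -> mu.-integrable D (EFin \o g) ->
  mu.-integrable D (EFin \o (fun t => r * f t + s * g t)).
Proof.
move=> mD jf jg; have -> : EFin \o (fun t => r * f t + s * g t) =
    ((EFin \o (fun t => r * f t)%R) \+ (EFin \o (fun t => s * g t)%R))%E.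
  by apply/funext => t; rewrite /= EFinD.
by apply: integrableD => //; exact: integrable_scale.
Qed.

Lemma locally_integrableZ (D : set R) (r : R) f :
  locally_integrable D f -> locally_integrable D (fun t => r * f t).
Proof.
move=> [mf oD intf]; split=> //; first exact: measurable_funM.
move=> K KD cK.
suff /integrableP[] : mu.-integrable K (EFin \o (fun t => r * f t)) by [].
apply: integrable_scale; first exact: compact_measurable.
apply/integrableP; split; last exact: intf.
apply/measurable_EFinP; apply: measurable_funS mf => //.
exact: open_measurable.
Qed.

Lemma Rintegral_lincomb (D : set R) f g (r s : R) : measurable D ->
  mu.-integrable D (EFin \o f) -> mu.-integrable D (EFin \o g) ->
  \int[mu]_(t in D) (r * f t + s * g t) =
  r * \int[mu]_(t in D) f t + s * \int[mu]_(t in D) g t.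
Proof.
move=> mD jf jg; rewrite RintegralD//; first by rewrite !RintegralZl.
  exact: integrable_scale.
exact: integrable_scale.
Qed.

Lemma Rintegral_test_lincomb a b f g phi (r s : R) :
  locally_integrable `]a, b[ f -> locally_integrable `]a, b[ g ->
  test_function a b phi ->
  \int[mu]_(t in `]a, b[) ((r * f t + s * g t) * phi t) =
  r * \int[mu]_(t in `]a, b[) (f t * phi t) +
  s * \int[mu]_(t in `]a, b[) (g t * phi t).
Proof.
move=> lf lg tphi; rewrite -Rintegral_lincomb; first last.
- exact: integrable_mul_test.
- exact: integrable_mul_test.
- exact: measurable_itv.
by apply: eq_Rintegral => t _; ring.
Qed.

Lemma locally_integrable_lincomb (D : set R) f g (r s : R) :
  locally_integrable D f -> locally_integrable D g ->
  locally_integrable D (fun t => r * f t + s * g t).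
Proof.
by move=> lf lg; apply: locally_integrableD; exact: locally_integrableZ.
Qed.

Lemma weakly_differentiable_lincomb a b f g (r s : R) :
  weakly_differentiable a b f -> weakly_differentiable a b g ->
  weakly_differentiable a b (fun t => r * f t + s * g t).
Proof.
move=> [f' [lf lf' ff']] [g' [lg lg' gg']].
exists (fun t => r * f' t + s * g' t).
split; try exact: locally_integrable_lincomb.
move=> phi tphi; rewrite !Rintegral_test_lincomb//; last first.
  exact: test_function_derive1.
by rewrite ff'// gg'// opprD !mulrN.
Qed.

Lemma spline_locally_integrable a b f :
  spline_space a b f -> locally_integrable `]a, b[ f.
Proof. by move=> [_ [g []]]. Qed.

Lemma weak_second_derivative_lincomb a b f g h k (r s : R) :
  locally_integrable `]a, b[ f -> locally_integrable `]a, b[ g ->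
  weak_second_derivative a b f h -> weak_second_derivative a b g k ->
  weak_second_derivative a b (fun t => r * f t + s * g t)
    (fun t => r * h t + s * k t).
Proof.
move=> lf lg [lh fh] [lk gk]; split; first exact: locally_integrable_lincomb.
move=> phi tphi; rewrite !Rintegral_test_lincomb//.
  by rewrite fh// gk.
by do 2 apply: test_function_derive1.
Qed.

Lemma sqr_lincomb_le (r s p q : R) :
  (r * p + s * q) ^+ 2 <= 2 * r ^+ 2 * p ^+ 2 + 2 * s ^+ 2 * q ^+ 2.
Proof.
rewrite -subr_ge0 [leRHS](_ : _ = (r * p - s * q) ^+ 2) ?sqr_ge0//; ring.
Qed.

Lemma integrable_sqr_lincomb (D : set R) h k (r s : R) : measurable D ->
  measurable_fun D h -> measurable_fun D k ->
  mu.-integrable D (EFin \o (fun t => h t ^+ 2)) ->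
  mu.-integrable D (EFin \o (fun t => k t ^+ 2)) ->
  mu.-integrable D (EFin \o (fun t => (r * h t + s * k t) ^+ 2)).
Proof.
move=> mD mh mk jh jk.
apply: (@le_integrable _ _ _ mu _ _ _ (EFin \o (fun t =>
    2 * r ^+ 2 * h t ^+ 2 + 2 * s ^+ 2 * k t ^+ 2))) => //.
- apply/measurable_EFinP; apply: measurable_funX.
  by apply: measurable_funD; apply: measurable_funM.
- move=> t _; rewrite lee_fin ger0_norm ?sqr_ge0// (le_trans _ (ler_norm _))//.
  exact: sqr_lincomb_le.
- exact: integrable_lincomb.
Qed.

(** The chosen second derivative of a combination need not be the
    combination of the chosen ones, but by uniqueness both have the same
    square integral. *)
Lemma spline_space_lincomb a b f g (r s : R) :
  spline_space a b f -> spline_space a b g ->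
  spline_space a b (fun t => r * f t + s * g t) /\
  roughness a b (fun t => r * f t + s * g t) =
  \int[mu]_(t in `[a, b]) ((r * weak_D2 a b f t + s * weak_D2 a b g t) ^+ 2).
Proof.
move=> sf sg.
have w2 : weak_second_derivative a b (fun t => r * f t + s * g t)
    (fun t => r * weak_D2 a b f t + s * weak_D2 a b g t).
  by apply: weak_second_derivative_lincomb;
    first [exact: spline_locally_integrable|exact: spline_weak_D2].
have ss : spline_space a b (fun t => r * f t + s * g t).
  have [cf wf _ _] := sf; have [cg wg _ _] := sg.
  apply: (spline_spaceI _ _ _ _ _ _ w2).
  - move=> t; apply: (@continuousD _ _ (subspace `[a, b])
      (fun t => r * f t) (fun t => s * g t)).
      apply: (@continuousM _ (subspace `[a, b]) (cst r) f).
        exact: cst_continuous.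
      exact: cf.
    apply: (@continuousM _ (subspace `[a, b]) (cst s) g).
      exact: cst_continuous.
    exact: cg.
  - exact: weakly_differentiable_lincomb.
  - have /integrableP[_] := integrable_sqr_lincomb `[a, b] _ _ r s
      (measurable_itv _) (weak_D2_measurable _ _ _ sf)
      (weak_D2_measurable _ _ _ sg) (weak_D2_sqr_integrable _ _ _ sf)
      (weak_D2_sqr_integrable _ _ _ sg).
    by under eq_integral do rewrite /= ger0_norm ?sqr_ge0//.
by split=> //; exact: roughnessE.
Qed.

Lemma derive_continuous f g : (forall t, is_derive t (1 : R) f (g t)) ->
  continuous f.
Proof.
move=> fg t; apply/differentiable_continuous/derivable1_diffP.
by have [] := fg t.
Qed.

Lemma continuous_locally_integrable a b f :
  continuous f -> locally_integrable `]a, b[ f.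
Proof.
move=> cf; split; [|exact: itv_open|].
  by apply: measurable_funTS; exact: continuous_measurable_fun.
move=> K _ cK.
suff /integrableP[] : mu.-integrable K (EFin \o f) by [].
by apply: continuous_compact_integrable => //; exact: continuous_subspaceT.
Qed.

Lemma test_function0 a b phi (t : R) : test_function a b phi ->
  ~ (a < t < b) -> phi t = 0.
Proof.
move=> [_ _ sub] tab; apply/eqP/negPn/negP => pt; apply: tab.
have := sub t; rewrite /= in_itv/=; apply; exact: subset_closure.
Qed.

Lemma derivable_oo_LRcontinuous_of_derive a b f g :
  (forall t, is_derive t (1 : R) f (g t)) -> derivable_oo_LRcontinuous f a b.
Proof.
move=> fg; have cf := derive_continuous _ _ fg; split.
- by move=> t _; have [] := fg t.
- by apply: cvg_at_right_filter; exact: cf.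
- by apply: cvg_at_left_filter; exact: cf.
Qed.

(** Integration by parts; the boundary terms vanish with the test
    function. *)
Lemma is_weak_derivative_of_C1 a b f g : a < b ->
  (forall t, is_derive t (1 : R) f (g t)) -> continuous g ->
  is_weak_derivative a b f g.
Proof.
move=> ab fg cg; have cf := derive_continuous _ _ fg.
have [lf lg] := (continuous_locally_integrable a b f cf,
                 continuous_locally_integrable a b g cg).
split=> // phi tphi; have [sphi _ _] := tphi.
have dphi := smooth_is_derive _ sphi.
have cphi' := smooth_continuous _ (smooth_derive1 _ sphi).
have cphi := smooth_continuous _ sphi.
rewrite (@Rintegral_itv_obnd_cbnd _ a (BLeft b)); last first.
  by apply: integrable_mul_test => //; exact: test_function_derive1.
rewrite (@Rintegral_itv_obnd_cbnd _ a (BLeft b)); last exact: integrable_mul_test.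
have icc u : continuous u -> mu.-integrable `[a, b] (EFin \o u).
  move=> cu; apply: continuous_compact_integrable; first exact: segment_compact.
  exact: continuous_subspaceT.
have ico u : continuous u -> mu.-integrable `[a, b[ (EFin \o u).
  by move=> cu; apply: integrableS (icc u cu) => //; exact: subset_itv_co_cc.
have cfp : continuous (fun t => f t * (phi^`())%classic t).
  by move=> t; apply: continuousM; [exact: cf|exact: cphi'].
have cgp : continuous (fun t => g t * phi t).
  by move=> t; apply: continuousM; [exact: cg|exact: cphi].
rewrite Rintegral_itv_bndo_bndc; last exact: ico.
rewrite Rintegral_itv_bndo_bndc; last exact: ico.
rewrite (@Rintegration_by_parts _ f phi g (phi^`())%classic a b)//.
- rewrite (test_function0 _ _ _ _ tphi) ?ltxx ?andbF//.
  rewrite (test_function0 _ _ _ _ tphi) ?ltxx//.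
  by rewrite !mulr0 subrr sub0r.
- exact: continuous_subspaceT.
- exact: derivable_oo_LRcontinuous_of_derive fg.
- by move=> t _; rewrite (is_derive_derive1 _ _ fg).
- exact: continuous_subspaceT.
- exact: derivable_oo_LRcontinuous_of_derive dphi.
Qed.

Lemma C2_spline a b f f' f'' : a < b ->
  (forall t, is_derive t (1 : R) f (f' t)) ->
  (forall t, is_derive t (1 : R) f' (f'' t)) -> continuous f'' ->
  spline_space a b f /\ weak_second_derivative a b f f''.
Proof.
move=> ab ff' ff'' cf''.
have wf : is_weak_derivative a b f f'.
  by apply: is_weak_derivative_of_C1 => //; exact: derive_continuous ff''.
have wf' : is_weak_derivative a b f' f''.
  exact: is_weak_derivative_of_C1.
have w2 := is_weak_derivative2 _ _ _ _ _ wf wf'.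
split=> //; apply: (spline_spaceI _ _ _ _ _ _ w2).
- by apply: continuous_subspaceT; exact: derive_continuous ff'.
- by exists f'.
- suff /integrableP[_] :
      mu.-integrable `[a, b] (EFin \o (fun t => f'' t ^+ 2)).
    by under eq_integral do rewrite /= ger0_norm ?sqr_ge0//.
  apply: continuous_compact_integrable; first exact: segment_compact.
  apply: continuous_subspaceT => t.
  have -> : (fun t => f'' t ^+ 2) = (fun t => f'' t * f'' t).
    by apply/funext => u; rewrite expr2.
  by apply: continuousM; exact: cf''.
Qed.

End WeakSecondDerivative.

(** * The Peano kernel identity *)

Section PeanoKernel.
Context {R : realType}.
Local Notation mu := (@lebesgue_measure R).
Implicit Types (a b : R) (f h : R -> R).

(** The truncated power [(t_+)^m]. *)
Definition truncpow (m : nat) (t : R) : R := if 0 < t then t ^+ m else 0.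

(** A smooth version of the positive part, equal to it outside [0, 1]. Its
    second derivative is supported in [0, 1] and has integral 1. *)
Definition ramp (t : R) : R := t * smooth_step t.

Lemma ramp_le0 (t : R) : t <= 0 -> ramp t = 0.
Proof. by move=> t0; rewrite /ramp smooth_step0// mulr0. Qed.

Lemma ramp_ge1 (t : R) : 1 <= t -> ramp t = t.
Proof. by move=> t1; rewrite /ramp smooth_step1// mulr1. Qed.

Lemma ramp_truncpow1 (t : R) : `|ramp t - truncpow 1 t| <= 1.
Proof.
rewrite /truncpow expr1; have [t0|t0] := ltP 0 t; last first.
  by rewrite ramp_le0// subrr normr0.
have [t1|t1] := leP 1 t; first by rewrite ramp_ge1// subrr normr0.
have /andP[h0 h1] := smooth_step_ge0_le1 t.
by rewrite /ramp ler_norml; nra.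
Qed.

Lemma smooth_ramp : smooth ramp.
Proof.
by apply/smoothP => n; apply: diffnM; [exact: diffn_id|exact: diffn_smooth_step].
Qed.

Definition dramp : R -> R := (ramp^`())%classic.
Definition ddramp : R -> R := (dramp^`())%classic.

Lemma dramp_le0 (t : R) : t < 0 -> dramp t = 0.
Proof.
move=> t0; rewrite /dramp derive1E (@near_eq_derive _ _ _ _ (cst 0)).
  by rewrite derive_cst.
by near=> u; rewrite ramp_le0//; near: u; exact: lt_le_nbhsl.
Unshelve. all: by end_near. Qed.

Lemma dramp_ge1 (t : R) : 1 < t -> dramp t = 1.
Proof.
move=> t1; rewrite /dramp derive1E (@near_eq_derive _ _ _ _ id).
  by rewrite derive_id.
by near=> u; rewrite ramp_ge1//; near: u; exact: lt_le_nbhsr.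
Unshelve. all: by end_near. Qed.

Lemma ddramp_out (t : R) : ~~ (0 <= t <= 1) -> ddramp t = 0.
Proof.
rewrite negb_and -!ltNge => /orP[t0|t1]; rewrite /ddramp derive1E.
  rewrite (@near_eq_derive _ _ _ _ (cst 0)) ?derive_cst//.
  by near=> u; rewrite dramp_le0//; near: u; exact: lt_nbhsl.
rewrite (@near_eq_derive _ _ _ _ (cst (1 : R))) ?derive_cst//.
by near=> u; rewrite dramp_ge1//; near: u; exact: lt_nbhsr.
Unshelve. all: by end_near. Qed.

Lemma continuous_ddramp : continuous ddramp.
Proof.
apply: smooth_continuous; apply: smooth_derive1; apply: smooth_derive1.
exact: smooth_ramp.
Qed.

Lemma continuous_scaled_ddramp (r s c : R) :
  continuous (fun t => r * ddramp (s * t + c)).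
Proof.
apply: smooth_continuous; apply/smoothP => n.
apply: diffnM; first exact: diffn_cst.
apply: diffn_comp_affine; move: n; apply/smoothP.
by apply: smooth_derive1; apply: smooth_derive1; exact: smooth_ramp.
Qed.

Lemma bounded_continuous01 (g : R -> R) : continuous g ->
  (forall t, ~~ (0 <= t <= 1) -> g t = 0) ->
  exists2 M, 0 <= M & forall t, `|g t| <= M.
Proof.
move=> cg g0.
have cn : {within `[0, 1], continuous (fun t => `|g t|)}.
  apply: continuous_subspaceT => t; apply: continuous_comp; first exact: cg.
  exact: norm_continuous.
have [c c01 cM] := EVT_max ler01 cn.
exists `|g c| => [|t]; first exact: normr_ge0.
have [t01|t01] := boolP (0 <= t <= 1); first by apply: cM; rewrite in_itv.
by rewrite g0// normr0 normr_ge0.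
Qed.

Lemma ddramp_bounded : exists2 M, 0 <= M & forall t, `|ddramp t| <= M.
Proof.
exact: bounded_continuous01 continuous_ddramp ddramp_out.
Qed.

Lemma truncpow1_lip (s t : R) : `|truncpow 1 s - truncpow 1 t| <= `|s - t|.
Proof.
rewrite /truncpow !expr1.
case: (ltP 0 s) => s0; case: (ltP 0 t) => t0 //; rewrite ?subr0 ?subrr ?normr0//.
  by rewrite !ger0_norm; lra.
by rewrite sub0r normrN distrC !ger0_norm; lra.
Qed.

Lemma scaled_ramp_truncpow1 (e z x t : R) : 0 < e ->
  `|e * ramp (e^-1 * t + - e^-1 * z) - truncpow 1 (t - x)| <= e + `|z - x|.
Proof.
move=> e0; have -> : e^-1 * t + - e^-1 * z = e^-1 * (t - z) by ring.
apply: le_trans (ler_distD (truncpow 1 (t - z)) _ _) _; apply: lerD; last first.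
  apply: le_trans (truncpow1_lip _ _) _.
  by rewrite (_ : _ - _ = - (z - x)) ?normrN//; ring.
have -> : truncpow 1 (t - z) = e * truncpow 1 (e^-1 * (t - z)).
  rewrite /truncpow !expr1 pmulr_rgt0 ?invr_gt0//.
  by case: ifP; rewrite ?mulr0// mulVKf// gt_eqF.
rewrite -mulrBr normrM gtr0_norm// -[leRHS]mulr1 ler_pM2l//.
exact: ramp_truncpow1.
Qed.

Lemma Rintegral_concentrated a b (u : R -> R) (z e K : R) :
  0 <= e -> a <= z -> z + e <= b -> mu.-integrable `[a, b] (EFin \o u) ->
  (forall t, ~~ (z <= t <= z + e) -> u t = 0) ->
  (forall t, z <= t <= z + e -> `|u t| <= K) ->
  `|\int[mu]_(t in `[a, b]) u t| <= K * e.
Proof.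
move=> e0 az zb iu u0 uK.
have sub : [set` `[z, z + e]] `<=` [set` `[a, b]].
  move=> t /=; rewrite !in_itv/= => /andP[zt tz].
  by rewrite (le_trans az zt) (le_trans tz zb).
have -> : \int[mu]_(t in `[a, b]) u t = \int[mu]_(t in `[z, z + e]) u t.
  rewrite Rintegral_mkcond [RHS]Rintegral_mkcond; apply: eq_Rintegral => t _.
  rewrite !patchE; case: ifPn => tab.
    case: ifPn => //; rewrite notin_setE/= in_itv/= => /negP tz.
    exact: u0.
  case: ifPn => //; rewrite inE => /sub tz.
  by move: tab; rewrite notin_setE.
have iz : mu.-integrable `[z, z + e] (EFin \o u).
  by apply: integrableS iu => //; exact: measurable_itv.
apply: le_trans (le_normr_Rintegral _ iz) _; first exact: measurable_itv.
have -> : K * e = \int[mu]_(t in `[z, z + e]) K.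
  rewrite Rintegral_cst//= lebesgue_measure_itv/= lte_fin ltrDl.
  have [e1|e1] := ltP 0 e; first by rewrite -EFinB /= addrAC subrr add0r.
  by have -> : e = 0 by lra.
apply: le_Rintegral; first exact: measurable_itv.
- exact: (integrable_norm iz).
- exact: integrable_cst_itv.
- by move=> t /=; rewrite in_itv/= => /uK.
Qed.

(** The integrand is the derivative of a rescaled [dramp], which goes
    from 0 to 1 between [z] and [z + e]. *)
Lemma integral_scaled_ddramp a b (e z : R) : 0 < e -> a < z -> z + e < b ->
  \int[mu]_(t in `[a, b]) (e^-1 * ddramp (e^-1 * t + - e^-1 * z)) = 1.
Proof.
move=> e0 az zb; have ab : a < b by lra.
have s2 := smooth_derive1 _ smooth_ramp.
have dG (t : R) : is_derive t (1 : R) (fun t => dramp (e^-1 * t + - e^-1 * z))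
    (e^-1 * ddramp (e^-1 * t + - e^-1 * z)).
  by apply: is_derive_comp_affine; exact: smooth_is_derive.
have cg : continuous (fun t => e^-1 * ddramp (e^-1 * t + - e^-1 * z)).
  exact: continuous_scaled_ddramp.
rewrite /Rintegral (continuous_FTC2 ab _
  (derivable_oo_LRcontinuous_of_derive a b _ _ dG)); first last.
- by move=> t _; rewrite (is_derive_derive1 _ _ dG).
- exact: continuous_subspaceT.
rewrite /= dramp_ge1; last first.
  by rewrite mulNr -mulrBr mulrC ltr_pdivlMr// mul1r; lra.
rewrite dramp_le0 ?subr0//.
by rewrite mulNr -mulrBr pmulr_rlt0 ?invr_gt0// subr_lt0.
Qed.

(** Knots may be endpoints of [a, b], whereas test functions vanish near them.
    An affine contraction towards the midpoint moves all knots inside and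
    preserves the relations [sum al = 0] and [sum al * x = 0] up to a factor, so
    the same weights can be kept. *)
Definition shrink a b (n : nat) (x : R) : R :=
  (1 - n.+1%:R^-1) * x + n.+1%:R^-1 * ((a + b) / 2).

Definition width a b (n : nat) : R := n.+1%:R^-1 * ((b - a) / 4).

Lemma width_gt0 a b n : a < b -> 0 < width a b n.
Proof.
by move=> ab; apply: mulr_gt0; [rewrite invr_gt0 ltr0n|lra].
Qed.

(** The width is a quarter of the contraction scale, so that a ramp starting
    at a contracted knot ends inside ]a, b[. *)
Lemma shrinkP a b n x : a < b -> a <= x <= b ->
  [/\ 0 < width a b n, a + width a b n <= shrink a b n x,
      shrink a b n x + width a b n + width a b n <= b &
      width a b n + `|shrink a b n x - x| <= n.+1%:R^-1 * (b - a)].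
Proof.
move=> ab /andP[ax xb]; rewrite /shrink /width.
have s0 : 0 < n.+1%:R^-1 :> R by rewrite invr_gt0 ltr0n.
have s1 : n.+1%:R^-1 <= 1 :> R by rewrite invf_le1 ?ltr0n// ler1n.
set s := n.+1%:R^-1 in s0 s1 *; split; [nra|nra|nra|].
have -> : (1 - s) * x + s * ((a + b) / 2) - x = s * ((a + b) / 2 - x) by ring.
rewrite normrM gtr0_norm// -mulrDr ler_pM2l//.
suff : `|(a + b) / 2 - x| <= (b - a) / 2 by lra.
by rewrite ler_norml; lra.
Qed.

Lemma dist_window (z x t w r : R) :
  w + `|z - x| < r -> z <= t <= z + w -> `|x - t| < r.
Proof.
move=> wr /andP[zt tz]; rewrite ltr_norml.
by have := ler_norm (z - x); have := ler_norm (- (z - x)); rewrite normrN; lra.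
Qed.

(** The rescaled second derivative of the ramp has integral 1 and is supported
    in an interval of length [width] that shrinks to [x]. It may change
    sign, but its L1 norm stays bounded, which is enough for an approximate
    identity. *)
Lemma delta_cvg a b f x : a < b -> {within `[a, b], continuous f} ->
  a <= x <= b ->
  \int[mu]_(t in `[a, b]) (f t * ((width a b n)^-1 *
    ddramp ((width a b n)^-1 * t + - (width a b n)^-1 * shrink a b n x)))
  @[n --> \oo] --> f x.
Proof.
move=> ab cf xab; have [M M0 ddM] := ddramp_bounded.
have cfx : f y @[y --> within [set` `[a, b]] (nbhs x)] --> f x.
  by move/subspace_continuousP : cf; apply; rewrite /= in_itv.
apply/cvgrPdist_le => e e0.
have eM : 0 < e / (M + 1) by apply: divr_gt0 => //; lra.
have : \forall y \near x, a <= y <= b -> `|f x - f y| <= e / (M + 1).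
  have /cvgrPdist_le/(_ _ eM) := cfx; rewrite near_withinE.
  by apply: filterS => y h yab; apply: h; rewrite /= in_itv.
move=> /nbhs_ballP[r /= r0 rP].
have rba : 0 < r / (b - a) by apply: divr_gt0 => //; lra.
near=> n.
have [w0 aw wb wx] := shrinkP a b n x ab xab.
have small : n.+1%:R^-1 * (b - a) < r.
  rewrite -ltr_pdivlMr; last lra.
  by near: n; exact: (near_infty_natSinv_lt (PosNum rba)).
move: w0 aw wb wx; set w := width a b n; set z := shrink a b n x.
move=> w0 aw wb wx.
have cg : continuous (fun t => w^-1 * ddramp (w^-1 * t + - w^-1 * z)).
  exact: continuous_scaled_ddramp.
have ig : mu.-integrable `[a, b]
    (EFin \o (fun t => w^-1 * ddramp (w^-1 * t + - w^-1 * z))).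
  apply: continuous_compact_integrable; first exact: segment_compact.
  exact: continuous_subspaceT.
have ifg : mu.-integrable `[a, b]
    (EFin \o (fun t => f t * (w^-1 * ddramp (w^-1 * t + - w^-1 * z)))).
  apply: continuous_compact_integrable; first exact: segment_compact.
  move=> t; apply: (@continuousM _ (subspace `[a, b]) f
    (fun t => w^-1 * ddramp (w^-1 * t + - w^-1 * z))); first exact: cf.
  exact: continuous_subspaceT.
(* The limit [f x] is written as an integral against the same kernel. *)
have one := integral_scaled_ddramp a b w z w0.
rewrite -[X in `|X - _|]mulr1 -one; [|lra..].
have -> : f x * \int[mu]_(t in `[a, b])
      (w^-1 * ddramp (w^-1 * t + - w^-1 * z)) -
    \int[mu]_(t in `[a, b])
      (f t * (w^-1 * ddramp (w^-1 * t + - w^-1 * z))) =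
    \int[mu]_(t in `[a, b])
      (f x * (w^-1 * ddramp (w^-1 * t + - w^-1 * z)) +
       (-1) * (f t * (w^-1 * ddramp (w^-1 * t + - w^-1 * z)))).
  by rewrite Rintegral_lincomb// mulN1r.
have inw t : (0 <= w^-1 * t + - w^-1 * z <= 1) = (z <= t <= z + w).
  rewrite mulNr -mulrBr pmulr_rge0 ?invr_gt0// subr_ge0.
  by rewrite mulrC ler_pdivrMr// mul1r lerBlDl.
apply: le_trans (Rintegral_concentrated a b _ z w
    (e / (M + 1) * (w^-1 * M)) (ltW w0) _ _ _ _ _) _; [lra|lra| | | |].
- exact: integrable_lincomb.
- by move=> t tz; rewrite ddramp_out ?inw// !mulr0 addr0.
- move=> t tz; rewrite mulN1r -mulrBl normrM; apply: ler_pM => //.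
    apply: rP; last lra.
    exact: (@dist_window z x t w r (le_lt_trans wx small) tz).
  by rewrite normrM gtr0_norm ?invr_gt0// ler_pM2l ?invr_gt0.
- have -> : e / (M + 1) * (w^-1 * M) * w = e * M / (M + 1).
    have wn : w != 0 by rewrite gt_eqF.
    have Mn : M + 1 != 0 by rewrite gt_eqF//; lra.
    by field; rewrite wn Mn.
  by rewrite ler_pdivrMr; nra.
Unshelve. all: by end_near. Qed.

Lemma diffn_sum n (I : finType) (F : I -> R -> R) :
  (forall i, diffn n (F i)) -> diffn n (fun t => \sum_i F i t).
Proof.
move=> cF; elim: (index_enum I) => [|i s IHs].
  by under eq_fun do rewrite big_nil; exact: diffn_cst.
by under eq_fun do rewrite big_cons; exact: diffnD.
Qed.

Lemma is_derive_fsum (I : finType) (F F' : I -> R -> R) (t : R) :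
  (forall i, is_derive t (1 : R) (F i) (F' i t)) ->
  is_derive t (1 : R) (fun u => \sum_i F i u) (\sum_i F' i t).
Proof.
move=> dF; elim: (index_enum I) => [|i s IHs].
  by under eq_fun do rewrite big_nil; rewrite big_nil; exact: is_derive_cst.
by under eq_fun do rewrite big_cons; rewrite big_cons; exact: is_derive_add.
Qed.

Lemma integrable_fsum (D : set R) (I : finType) (F : I -> R -> R) :
  measurable D -> (forall i, mu.-integrable D (EFin \o F i)) ->
  mu.-integrable D (EFin \o (fun t => \sum_i F i t)).
Proof.
move=> mD iF; rewrite (_ : _ \o _ = (fun t => \sum_(i : I) (EFin \o F i) t)%E).
  by apply: integrable_sum => // i _; exact: iF.
by apply/funext => t; rewrite /= sumEFin.
Qed.

Lemma Rintegral_fsum (D : set R) (I : finType) (F : I -> R -> R) :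
  measurable D -> (forall i, mu.-integrable D (EFin \o F i)) ->
  \int[mu]_(t in D) (\sum_i F i t) = \sum_i \int[mu]_(t in D) F i t.
Proof.
move=> mD iF; rewrite /Rintegral; under eq_integral do rewrite -sumEFin.
rewrite integral_sum// sum_fine// => i _.
by apply: integrable_fin_num => //; exact: iF.
Qed.

Lemma cvg_fsum (T : Type) (FF : set_system T) (I : finType)
    (F : I -> T -> R) (l : I -> R) : Filter FF ->
  (forall i, F i t @[t --> FF] --> l i) ->
  \sum_i F i t @[t --> FF] --> \sum_i l i.
Proof.
move=> fF cF; elim: (index_enum I) => [|i s IHs].
  by under eq_fun do rewrite big_nil; rewrite big_nil; exact: cvg_cst.
by under eq_fun do rewrite big_cons; rewrite big_cons; exact: cvgD.
Qed.

Lemma continuous_truncpow1 : continuous (truncpow 1).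
Proof.
move=> t; apply/cvgrPdist_le => e e0; near=> u.
apply: le_trans (truncpow1_lip _ _) _; near: u.
by apply: cvgr_dist_le => //; exact: cvg_id.
Unshelve. all: by end_near. Qed.

Lemma integrable_continuousM a b (g u : R -> R) :
  mu.-integrable `[a, b] (EFin \o g) -> continuous u ->
  mu.-integrable `[a, b] (EFin \o (fun t => g t * u t)).
Proof.
move=> ig cu; have -> : EFin \o (fun t => g t * u t) =
    ((EFin \o g) \* (EFin \o u))%E by apply/funext => t; rewrite /= EFinM.
have cw : {within `[a, b], continuous u} by exact: continuous_subspaceT.
apply: integrableMl => //.
  exact: measurable_funTS (continuous_measurable_fun cu).
have /compact_bounded[M [_ mrt]] := continuous_compact cw (@segment_compact _ a b).
by exists M; split; rewrite ?num_real // => ? ? ? ?; exact: mrt.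
Qed.

Section Peano.
Variables (I : finType) (a b : R) (f h : R -> R) (al x : I -> R).
Hypotheses (ab : a < b) (cf : {within `[a, b], continuous f}).
Hypotheses (fh : weak_second_derivative a b f h)
  (ih : mu.-integrable `[a, b] (EFin \o h)).
Hypotheses (xab : forall i, a <= x i <= b) (al0 : \sum_i al i = 0)
  (alx0 : \sum_i al i * x i = 0).

Let spike n i t : R := width a b n * ramp ((width a b n)^-1 * t +
  - (width a b n)^-1 * shrink a b n (x i)).

Let smoothed n t : R := \sum_i al i * spike n i t.

Let kernel t : R := \sum_i al i * truncpow 1 (t - x i).

Lemma smoothed_derive2 n :
  ((smoothed n)^`()^`())%classic = fun t => \sum_i al i *
    ((width a b n)^-1 * ddramp ((width a b n)^-1 * t +
      - (width a b n)^-1 * shrink a b n (x i))).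
Proof.
have wn : width a b n != 0 by rewrite gt_eqF// width_gt0.
have d1 t : is_derive t (1 : R) (smoothed n) (\sum_i al i * dramp
    ((width a b n)^-1 * t + - (width a b n)^-1 * shrink a b n (x i))).
  apply: (@is_derive_fsum _ (fun i t => al i * spike n i t) (fun i t => al i *
    dramp ((width a b n)^-1 * t + - (width a b n)^-1 * shrink a b n (x i)))).
  move=> i; have : is_derive t (1 : R) (spike n i) (width a b n *
      ((width a b n)^-1 * dramp ((width a b n)^-1 * t +
        - (width a b n)^-1 * shrink a b n (x i)))).
    apply: is_derive_scale; apply: is_derive_comp_affine.
    exact: smooth_is_derive smooth_ramp _.
  by rewrite mulVKf// => d; apply: is_derive_scale.
rewrite (is_derive_derive1 _ _ d1); apply: is_derive_derive1 => t.
apply: (@is_derive_fsum _ (fun i t => al i * dramp ((width a b n)^-1 * t +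
    - (width a b n)^-1 * shrink a b n (x i))) (fun i t => al i *
  ((width a b n)^-1 * ddramp ((width a b n)^-1 * t +
    - (width a b n)^-1 * shrink a b n (x i))))) => i.
apply: is_derive_scale; apply: is_derive_comp_affine.
exact: smooth_is_derive (smooth_derive1 _ smooth_ramp) _.
Qed.

(** To the right of all ramps the function equals
    [sum_i al i * (t - z_i)], which is 0 by the two relations on [al]. *)
Lemma smoothed_test n : test_function a b (smoothed n).
Proof.
pose w := width a b n.
have w0 : 0 < w by exact: width_gt0.
apply: (test_function_itv a b (a + w) (b - w)); [lra|lra| |].
  apply/smoothP => m; apply: diffn_sum => i; apply: diffnM; first exact: diffn_cst.
  apply: diffnM; first exact: diffn_cst.
  by apply: diffn_comp_affine; move: m; apply/smoothP; exact: smooth_ramp.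
move=> t; apply: contraNT; rewrite negb_and -!ltNge => /orP[ta|tb].
  apply/eqP; rewrite /smoothed big1// => i _.
  have [_ az _ _] := shrinkP a b n (x i) ab (xab i).
  rewrite /spike ramp_le0 ?mulr0// mulNr -mulrBr pmulr_rle0 ?invr_gt0//.
  by move: az; rewrite -/w; lra.
have -> : smoothed n t = \sum_i al i * (t - shrink a b n (x i)).
  apply: eq_bigr => i _; congr (_ * _).
  have [_ _ zb _] := shrinkP a b n (x i) ab (xab i).
  rewrite /spike ramp_ge1 mulNr -mulrBr -/w.
    by rewrite mulVKf// gt_eqF.
  by rewrite mulrC ler_pdivlMr// mul1r; move: zb; rewrite -/w; lra.
have -> : \sum_i al i * (t - shrink a b n (x i)) =
    (t - n.+1%:R^-1 * ((a + b) / 2)) * (\sum_i al i) -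
    (1 - n.+1%:R^-1) * (\sum_i al i * x i).
  rewrite !mulr_sumr -sumrB; apply: eq_bigr => i _; rewrite /shrink; ring.
by rewrite al0 alx0 !mulr0 subrr.
Qed.

Lemma smoothed_close n t :
  `|smoothed n t - kernel t| <= (\sum_i `|al i|) * (n.+1%:R^-1 * (b - a)).
Proof.
rewrite /smoothed /kernel -sumrB mulr_suml.
apply: le_trans (ler_norm_sum _ _ _) _; apply: ler_sum => i _.
rewrite -mulrBr normrM ler_wpM2l//.
have [w0 _ _ wx] := shrinkP a b n (x i) ab (xab i).
exact: le_trans (scaled_ramp_truncpow1 _ _ _ _ w0) wx.
Qed.

Lemma continuous_kernel : continuous kernel.
Proof.
move=> t; apply: cvg_fsum => i.
apply: cvgM; first exact: cvg_cst.
apply: (@continuous_comp _ _ _ (fun t => t - x i) (truncpow 1)).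
  by apply: continuousB; [exact: cvg_id|exact: cst_continuous].
exact: continuous_truncpow1.
Qed.

(** Both sides are the limit of the integrals of [h * smoothed n]. These equal
    the integrals of [f] against the second derivative of [smoothed n], an
    approximate identity at each knot; and [smoothed n] tends uniformly to the
    kernel. *)
Lemma peano_kernel :
  \int[mu]_(t in `[a, b]) (h t * \sum_i al i * truncpow 1 (t - x i)) =
  \sum_i al i * f (x i).
Proof.
have [lh h2] := fh.
have ismooth n := smoothed_test n.
have csm n : continuous (smoothed n).
  by apply: smooth_continuous; case: (ismooth n).
have ihk := integrable_continuousM a b h kernel ih continuous_kernel.
have ihs n := integrable_continuousM a b h (smoothed n) ih (csm n).
have itv_oo_cc (u : R -> R) : measurable_fun `]a, b[ u ->
    \int[mu]_(t in `]a, b[) u t = \int[mu]_(t in `[a, b]) u t.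
  move=> mu_; rewrite /Rintegral (integral_itv_bndoo true false)//.
  exact/measurable_EFinP.
have moo (u : R -> R) : mu.-integrable `[a, b] (EFin \o u) ->
    measurable_fun `]a, b[ u.
  move=> iu; apply/measurable_EFinP; apply: (@measurable_int _ _ _ mu).
  by apply: integrableS iu => //; exact: subset_itv_oo_cc.
have scaled_cont n i : continuous (fun t => (width a b n)^-1 *
    ddramp ((width a b n)^-1 * t + - (width a b n)^-1 * shrink a b n (x i))).
  exact: continuous_scaled_ddramp.
have idelta n i : mu.-integrable `[a, b] (EFin \o (fun t => f t *
    ((width a b n)^-1 * ddramp ((width a b n)^-1 * t +
      - (width a b n)^-1 * shrink a b n (x i))))).
  apply: integrable_continuousM => //.
  by apply: continuous_compact_integrable => //; exact: segment_compact.
have eqn n : \int[mu]_(t in `[a, b]) (h t * smoothed n t) =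
    \sum_i al i * \int[mu]_(t in `[a, b]) (f t * ((width a b n)^-1 *
      ddramp ((width a b n)^-1 * t +
        - (width a b n)^-1 * shrink a b n (x i)))).
  rewrite -itv_oo_cc; last exact: moo (ihs n).
  rewrite -(h2 _ (ismooth n)) smoothed_derive2.
  under eq_bigr => i _ do rewrite -RintegralZl//.
  rewrite -Rintegral_fsum => [|//|i]; last first.
    by apply: integrable_scale => //; exact: idelta.
  rewrite -itv_oo_cc; last first.
    apply: moo; apply: integrable_fsum => // i.
    by apply: integrable_scale => //; exact: idelta.
  by apply: eq_Rintegral => t _; rewrite mulr_sumr; apply: eq_bigr => i _; ring.
have lim1 : \int[mu]_(t in `[a, b]) (h t * smoothed n t) @[n --> \oo] -->
    \sum_i al i * f (x i).
  under eq_fun do rewrite eqn.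
  apply: cvg_fsum => i; apply: cvgM; first exact: cvg_cst.
  exact: delta_cvg.
have lim2 : \int[mu]_(t in `[a, b]) (h t * smoothed n t) @[n --> \oo] -->
    \int[mu]_(t in `[a, b]) (h t * kernel t).
  pose H := \int[mu]_(t in `[a, b]) `|h t|.
  pose C := (\sum_i `|al i|) * (b - a) * H.
  have idiff n : mu.-integrable `[a, b]
      (EFin \o (fun t => h t * smoothed n t - h t * kernel t)).
    rewrite (_ : (fun t => _) = fun t => 1 * (h t * smoothed n t) +
        (-1) * (h t * kernel t)); first exact: integrable_lincomb.
    by apply/funext => t; rewrite mul1r mulN1r.
  have bound n : `|\int[mu]_(t in `[a, b]) (h t * smoothed n t) -
      \int[mu]_(t in `[a, b]) (h t * kernel t)| <= n.+1%:R^-1 * C.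
    rewrite -RintegralB//.
    apply: le_trans (le_normr_Rintegral _ _) _.
    - exact: measurable_itv.
    - exact: idiff.
    have -> : n.+1%:R^-1 * C = \int[mu]_(t in `[a, b])
        ((\sum_i `|al i|) * (n.+1%:R^-1 * (b - a)) * `|h t|).
      by rewrite RintegralZl ?/C -/H//; [ring|exact: (integrable_norm ih)].
    apply: le_Rintegral => //.
    - exact: (integrable_norm (idiff n)).
    - by apply: integrable_scale => //; exact: (integrable_norm ih).
    - move=> t _; rewrite -mulrBr normrM mulrC ler_wpM2r//.
      exact: smoothed_close.
  apply/cvgrPdist_le => e e0.
  have C0 : 0 <= C.
    apply: mulr_ge0; last by apply: Rintegral_ge0.
    by apply: mulr_ge0; [exact: sumr_ge0|rewrite subr_ge0 ltW].
  have eC : 0 < e / (C + 1) by apply: divr_gt0 => //; lra.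
  near=> n; rewrite distrC; apply: le_trans (bound n) _.
  have small : n.+1%:R^-1 < e / (C + 1).
    by near: n; exact: (near_infty_natSinv_lt (PosNum eC)).
  apply: (@le_trans _ _ (e / (C + 1) * C)).
    by rewrite ler_wpM2r// ltW.
  rewrite mulrAC ler_pdivrMr; last exact: ltr_wpDl.
  by rewrite ler_pM2l// lerDl.
exact: (cvg_unique _ lim2 lim1).
Unshelve. all: by end_near. Qed.

End Peano.

End PeanoKernel.

(** * Quadratic forms and spectral similarity *)

Section QuadraticForms.
Context {R : realType}.

Lemma quadformE N (A : 'M[R]_N) (u : 'cV[R]_N) :
  quadform A u = \sum_i \sum_j u i 0 * A i j * u j 0.
Proof.
rewrite /quadform !mxE exchange_big; apply: eq_bigr => j _.
by rewrite !mxE mulr_suml; apply: eq_bigr => i _; rewrite !mxE.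
Qed.

Lemma quadform_diag N (w : 'I_N -> R) (u : 'cV[R]_N) :
  quadform (diag_mx (\row_i w i)) u = \sum_i w i * u i 0 ^+ 2.
Proof.
rewrite quadformE; apply: eq_bigr => i _.
rewrite (bigD1 i)//= big1 ?addr0; last first.
  by move=> j ji; rewrite !mxE eq_sym (negbTE ji) mulr0n mulr0 mul0r.
by rewrite !mxE eqxx mulr1n; ring.
Qed.

(** With [y_i = v_i / w_i], an off-diagonal term is at most
    [A i j * w i * w j * (y_i^2 + y_j^2) / 2] in absolute value. By symmetry and
    the bound on the weighted row sums, these add up to at most a third of the
    sum of the [w i * y_i^2], to be compared with the diagonal part, which is
    two thirds of it. *)
Lemma diag_dominant_quadform N (A : 'M[R]_N) (w : 'I_N -> R) :
  (forall i, 0 < w i) -> A^T = A -> (forall i j, 0 <= A i j) ->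
  (forall i, A i i * w i = 2 / 3) ->
  (forall i, \sum_(j | j != i) A i j * w j <= 1 / 3) ->
  forall v : 'cV[R]_N,
    1 / 3 * (\sum_i v i 0 ^+ 2 / w i) <= quadform A v <=
    \sum_i v i 0 ^+ 2 / w i.
Proof.
move=> w0 AT A0 Adiag Aoff v.
have wn i : w i != 0 by rewrite gt_eqF.
pose off := \sum_i \sum_(j | j != i) v i 0 * A i j * v j 0.
have qE : quadform A v = 2 / 3 * (\sum_i v i 0 ^+ 2 / w i) + off.
  rewrite quadformE /off mulr_sumr -big_split; apply: eq_bigr => i _ /=.
  rewrite (bigD1 i)//=; congr (_ + _).
  have -> : A i i = 2 / 3 / w i by rewrite -(Adiag i) mulfK.
  by rewrite expr2; ring.
(* The bounds of the off-diagonal terms, with [y_j^2] moved to [y_i^2] by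
   symmetry. *)
pose S := \sum_i \sum_(j | j != i) A i j * w j * (v i 0 ^+ 2 / w i).
have symS : S = \sum_i \sum_(j | j != i) A i j * w i * (v j 0 ^+ 2 / w j).
  rewrite /S (exchange_big_dep xpredT)//=; apply: eq_bigr => i _.
  apply: eq_big => [j|j ji]; first by rewrite eq_sym.
  by rewrite -[in LHS]AT mxE.
have S3 : S <= 1 / 3 * (\sum_i v i 0 ^+ 2 / w i).
  rewrite /S mulr_sumr; apply: ler_sum => i _; rewrite -mulr_suml.
  by apply: ler_wpM2r => //; rewrite divr_ge0 ?sqr_ge0// ltW.
have offS : `|off| <= S.
  have -> : S = \sum_i \sum_(j | j != i) (A i j * w j * (v i 0 ^+ 2 / w i) +
      A i j * w i * (v j 0 ^+ 2 / w j)) / 2.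
    transitivity ((S + S) / 2); first by field.
    rewrite {2}symS /S -big_split mulr_suml; apply: eq_bigr => i _ /=.
    by rewrite -big_split mulr_suml.
  apply: le_trans (ler_norm_sum _ _ _) _; apply: ler_sum => i _.
  apply: le_trans (ler_norm_sum _ _ _) _; apply: ler_sum => j _.
  have -> : (A i j * w j * (v i 0 ^+ 2 / w i) +
      A i j * w i * (v j 0 ^+ 2 / w j)) / 2 =
      A i j * (w i * w j * ((v i 0 / w i) ^+ 2 + (v j 0 / w j) ^+ 2) / 2).
    by field; rewrite !wn.
  have -> : v i 0 * A i j * v j 0 =
      A i j * (w i * w j * ((v i 0 / w i) * (v j 0 / w j))).
    by field; rewrite !wn.
  rewrite normrM ger0_norm// ler_wpM2l// normrM ger0_norm; last first.
    by rewrite mulr_ge0// ltW.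
  rewrite -[leRHS]mulrA ler_wpM2l//; first by rewrite mulr_ge0// ltW.
  set p := v i 0 / w i; set q := v j 0 / w j.
  have := sqr_ge0 (p - q); have := sqr_ge0 (p + q).
  by rewrite !expr2 ler_norml => h1 h2; apply/andP; split; lra.
move: offS; rewrite ler_norml => /andP[lo hi].
by rewrite qE; apply/andP; split; lra.
Qed.

Lemma cauchy_weighted N (w u v : 'I_N -> R) (c : R) : 0 < c ->
  (forall i, 0 < w i) ->
  2 * (\sum_i u i * v i) <=
  c * (\sum_i w i * u i ^+ 2) + c^-1 * (\sum_i v i ^+ 2 / w i).
Proof.
move=> c0 w0; rewrite !mulr_sumr -big_split; apply: ler_sum => i _ /=.
have wn : w i != 0 by rewrite gt_eqF.
have cn : c != 0 by rewrite gt_eqF.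
rewrite -subr_ge0.
have -> : c * (w i * u i ^+ 2) + c^-1 * (v i ^+ 2 / w i) - 2 * (u i * v i) =
    c * w i * (u i - v i / (c * w i)) ^+ 2 by field; rewrite cn wn.
by rewrite mulr_ge0 ?sqr_ge0// mulr_ge0// ltW.
Qed.

Lemma dotmxE N (u v : 'cV[R]_N) : (u^T *m v) 0 0 = \sum_i u i 0 * v i 0.
Proof. by rewrite mxE; apply: eq_bigr => i _; rewrite !mxE. Qed.

(** Let [K] be the inverse of [A], [W] the diagonal matrix of [w], and
    [q = u^T K u], which is also [(K u)^T A (K u)]. The upper bound is Cauchy's
    inequality for [u^T (K u)], in which the norm of [K u] for [W^-1] is at most
    [3 q]. The lower bound follows from the positivity of [A] at
    [W u - K u]. *)
Lemma invmx_spectrally_similar N (A : 'M[R]_N) (w : 'I_N -> R) :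
  (forall i, 0 < w i) -> A^T = A ->
  (forall v : 'cV[R]_N, 1 / 3 * (\sum_i v i 0 ^+ 2 / w i) <= quadform A v <=
    \sum_i v i 0 ^+ 2 / w i) ->
  A \in unitmx /\ spectrally_similar 3 1 (invmx A) (diag_mx (\row_i w i)).
Proof.
move=> w0 AT Aw.
have wn i : w i != 0 by rewrite gt_eqF.
have A0 v : 0 <= quadform A v.
  have /andP[+ _] := Aw v; apply: le_trans.
  by rewrite mulr_ge0// sumr_ge0// => i _; rewrite divr_ge0 ?sqr_ge0// ltW.
have Au : A \in unitmx.
  rewrite -row_free_unit -kermx_eq0; apply/eqP/row_matrixP => k.
  rewrite row0; set z := row k _.
  have zA : z *m A = 0.
    by apply/sub_kermxP; exact: row_sub.
  have /andP[+ _] := Aw z^T; rewrite /quadform trmxK zA mul0mx mxE => h.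
  have h0 : \sum_i z^T i 0 ^+ 2 / w i <= 0 by lra.
  have hp i : 0 <= z^T i 0 ^+ 2 / w i by rewrite divr_ge0 ?sqr_ge0// ltW.
  have /eqP := le_anti (introT andP (conj h0 (sumr_ge0 _ (fun i _ => hp i)))).
  rewrite psumr_eq0// => /allP hz; apply/rowP => i.
  have := hz i (mem_index_enum i).
  rewrite mulf_eq0 invr_eq0 (negbTE (wn i)) orbF.
  by rewrite sqrf_eq0 !mxE => /eqP.
split=> //; set K := invmx A.
have KT : K^T = K by rewrite /K trmx_inv AT.
have KA (u : 'cV[R]_N) : A *m (K *m u) = u by rewrite mulmxA mulmxV// mul1mx.
have KE (u : 'cV[R]_N) : quadform K u = quadform A (K *m u).
  by rewrite /quadform trmx_mul KT -[in RHS]mulmxA KA.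
have Kdot (u : 'cV[R]_N) : quadform K u = \sum_i u i 0 * (K *m u) i 0.
  by rewrite /quadform -mulmxA dotmxE.
split.
- by split=> // u; rewrite KE.
- split; first exact: tr_diag_mx.
  move=> u; rewrite quadform_diag sumr_ge0// => i _.
  by rewrite mulr_ge0 ?sqr_ge0// ltW.
- exact: ltr01.
- by rewrite lexx ler1n.
move=> u; rewrite mul1r quadform_diag; apply/andP; split.
  (* By [A <= W^-1], the form of [W u - K u] is at most [q - u^T W u]. *)
  pose z := (\col_i (w i * u i 0)) - K *m u.
  have := A0 z; have -> : quadform A z = quadform A (\col_i (w i * u i 0)) -
      2 * (\sum_i w i * u i 0 ^+ 2) + quadform K u.
    rewrite KE /z; set p := \col_i _; set k := K *m u.
    have Ak : A *m k = u by exact: KA.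
    have e1 : (p^T *m u) 0 0 = \sum_i w i * u i 0 ^+ 2.
      by rewrite dotmxE; apply: eq_bigr => i _; rewrite !mxE; ring.
    have e2 : (k^T *m (A *m p)) 0 0 = \sum_i w i * u i 0 ^+ 2.
      rewrite mulmxA -{1}AT -trmx_mul Ak dotmxE.
      by apply: eq_bigr => i _; rewrite !mxE; ring.
    have entryB (P Q : 'M[R]_1) : (P - Q) 0 0 = P 0 0 - Q 0 0 by rewrite !mxE.
    have zT : (p - k)^T = p^T - k^T by apply/matrixP => i j; rewrite !mxE.
    rewrite /quadform -!mulmxA mulmxBr Ak zT mulmxBl !mulmxBr !entryB.
    by rewrite e1 e2; ring.
  have /andP[_] := Aw (\col_i (w i * u i 0)).
  have -> : \sum_i (\col_j (w j * u j 0)) i 0 ^+ 2 / w i =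
      \sum_i w i * u i 0 ^+ 2.
    by apply: eq_bigr => i _; rewrite mxE; field; rewrite wn.
  lra.
have := cauchy_weighted N w (fun i => u i 0) (fun i => (K *m u) i 0) 3
  (ltr0Sn _ _) w0.
by rewrite -Kdot; have /andP[+ _] := Aw (K *m u); rewrite -KE; lra.
Qed.

End QuadraticForms.

(** * The tridiagonal matrix of the knots *)

Section Knots.
Context {R : realType} {n : nat} (x : 'I_n -> R).
Hypothesis hx : forall i j : 'I_n, (i < j)%N -> x i < x j.

(** The diagonal of [W2mx]. *)
Definition half_gap (i : 'I_(n - 2)) : R := (x (knot2 i) - x (knot0 i)) / 2.

(** A row of [D2mx], as a functional on functions: twice the divided
    difference of order two at [p], [q], [r]. *)
Definition second_difference (p q r : R) (F : R -> R) : R :=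
  2 / (r - p) * ((F r - F q) / (r - q) - (F q - F p) / (q - p)).

Lemma knots_mono (i j : 'I_n) : (i <= j)%N -> x i <= x j.
Proof.
rewrite leq_eqVlt => /orP[/eqP/val_inj->//|ij]; exact/ltW/hx.
Qed.

Lemma knot0_lt_knot1 (i : 'I_(n - 2)) : x (knot0 i) < x (knot1 i).
Proof. by apply: hx; rewrite /= addn0 addn1. Qed.

Lemma knot1_lt_knot2 (i : 'I_(n - 2)) : x (knot1 i) < x (knot2 i).
Proof. by apply: hx; rewrite /= addn1 addn2. Qed.

Lemma half_gap_gt0 i : 0 < half_gap i.
Proof.
by have := knot0_lt_knot1 i; have := knot1_lt_knot2 i; rewrite /half_gap; lra.
Qed.

(** Consecutive triples of knots overlap in two points. *)
Lemma knot0S (i j : 'I_(n - 2)) : i = j.+1 :> nat -> knot0 i = knot1 j.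
Proof. by move=> ij; apply/val_inj => /=; rewrite ij addn0 addn1. Qed.

Lemma knot1S (i j : 'I_(n - 2)) : i = j.+1 :> nat -> knot1 i = knot2 j.
Proof. by move=> ij; apply/val_inj => /=; rewrite ij addn1 addn2. Qed.

Lemma K2inv_eq i : K2inv x i i = 2 / 3 / half_gap i.
Proof.
have := half_gap_gt0 i; rewrite /half_gap => h.
have n0 : x (knot2 i) - x (knot0 i) != 0 by rewrite gt_eqF//; lra.
by rewrite mxE eqxx; field.
Qed.

Lemma K2inv_succ (i j : 'I_(n - 2)) : i = j.+1 :> nat ->
  K2inv x i j = (x (knot1 i) - x (knot0 i)) / (6 * half_gap i * half_gap j).
Proof.
move=> ij; have ji : (i == j) = false.
  by apply/negbTE/eqP => e; move: ij; rewrite e => /n_Sn.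
rewrite mxE ji ij eqxx /K2inv_offdiag (knot1S _ _ ij).
have := half_gap_gt0 i; have := half_gap_gt0 j; rewrite /half_gap => h1 h2.
have n1 : x (knot2 i) - x (knot0 i) != 0 by rewrite gt_eqF//; lra.
have n2 : x (knot2 j) - x (knot0 j) != 0 by rewrite gt_eqF//; lra.
by field; rewrite n1 n2.
Qed.

Lemma K2inv_pred (i j : 'I_(n - 2)) : j = i.+1 :> nat ->
  K2inv x i j = (x (knot1 j) - x (knot0 j)) / (6 * half_gap i * half_gap j).
Proof.
move=> ij; have ji : (i == j) = false.
  by apply/negbTE/eqP => e; move: ij; rewrite e => /n_Sn.
have ji' : (i == j.+1 :> nat) = false by apply/negbTE; lia.
have := half_gap_gt0 i; have := half_gap_gt0 j.
rewrite mxE ji ji' ij eqxx /K2inv_offdiag (knot1S _ _ ij) /half_gap => h1 h2.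
have n1 : x (knot2 i) - x (knot0 i) != 0 by rewrite gt_eqF//; lra.
have n2 : x (knot2 j) - x (knot0 j) != 0 by rewrite gt_eqF//; lra.
by field; rewrite n1 n2.
Qed.

Lemma K2inv_far (i j : 'I_(n - 2)) : i != j -> i != j.+1 :> nat ->
  j != i.+1 :> nat -> K2inv x i j = 0.
Proof. by move=> h1 h2 h3; rewrite mxE !ifN. Qed.

Lemma K2inv_sym : (K2inv x)^T = K2inv x.
Proof.
apply/matrixP => i j; rewrite mxE.
have [->//|ij] := eqVneq i j.
have [e|ne1] := eqVneq (i : nat) j.+1.
  by rewrite (K2inv_pred _ _ e) (K2inv_succ _ _ e) mulrAC.
have [e|ne2] := eqVneq (j : nat) i.+1.
  by rewrite (K2inv_pred _ _ e) (K2inv_succ _ _ e) mulrAC.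
by rewrite !K2inv_far// eq_sym.
Qed.

Lemma K2inv_ge0 i j : 0 <= K2inv x i j.
Proof.
have hi := half_gap_gt0 i; have hj := half_gap_gt0 j.
have [->|ij] := eqVneq i j.
  by rewrite K2inv_eq; apply: divr_ge0; [exact: divr_ge0|exact: ltW].
have [e|ne1] := eqVneq (i : nat) j.+1.
  rewrite (K2inv_succ _ _ e) divr_ge0//.
    by rewrite subr_ge0 ltW// knot0_lt_knot1.
  by do 2! [apply: mulr_ge0 => //; last exact: ltW].
have [e|ne2] := eqVneq (j : nat) i.+1.
  rewrite (K2inv_pred _ _ e) divr_ge0//.
    by rewrite subr_ge0 ltW// knot0_lt_knot1.
  by do 2! [apply: mulr_ge0 => //; last exact: ltW].
by rewrite K2inv_far.
Qed.

(** A row has at most one off-diagonal entry on each side of the diagonal; one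
    of them is missing at the two ends, whence an inequality. *)
Lemma sum_at_most_one (I : finType) (P : pred I) (F : I -> R) (c : R) :
  0 <= c -> (forall i j, P i -> P j -> i = j) -> (forall i, P i -> F i = c) ->
  \sum_(i | P i) F i <= c.
Proof.
move=> c0 P1 Fc; have [i Pi|P0] := pickP P; last by rewrite big_pred0.
rewrite (bigD1 i)//= big1 ?addr0 ?Fc// => j /andP[Pj].
by rewrite (P1 _ _ Pj Pi) eqxx.
Qed.

(** The entries before and after the diagonal contribute the lengths of
    the two intervals between the three knots, divided by [6 * half_gap i]; the
    two lengths add up to [2 * half_gap i]. *)
Lemma K2inv_offdiag_sum i :
  \sum_(j | j != i) K2inv x i j * half_gap j <= 1 / 3.
Proof.
have hi := half_gap_gt0 i.
have h01 := knot0_lt_knot1 i; have h12 := knot1_lt_knot2 i.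
have hn : half_gap i != 0 by rewrite gt_eqF.
rewrite (bigID (fun j : 'I_(n - 2) => i == j.+1 :> nat))/=.
rewrite [X in _ + X](bigID (fun j : 'I_(n - 2) => j == i.+1 :> nat))/=.
rewrite [X in _ + (_ + X)]big1 ?addr0; last first.
  move=> j /andP[/andP[ji ne1] ne2]; rewrite K2inv_far ?mul0r//.
  by rewrite eq_sym.
have -> : 1 / 3 = (x (knot1 i) - x (knot0 i)) / (6 * half_gap i) +
    (x (knot2 i) - x (knot1 i)) / (6 * half_gap i).
  rewrite -mulrDl; have -> : x (knot1 i) - x (knot0 i) +
    (x (knot2 i) - x (knot1 i)) = 2 * half_gap i by rewrite /half_gap; field.
  by field.
apply: lerD; apply: sum_at_most_one.
- by apply: divr_ge0; [rewrite subr_ge0 ltW|apply: mulr_ge0 => //; exact: ltW].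
- by move=> j k /andP[_ /eqP ej] /andP[_ /eqP ek]; apply/val_inj => /=; lia.
- move=> j /andP[_ /eqP ej]; rewrite (K2inv_succ _ _ ej).
  have hj : half_gap j != 0 by rewrite gt_eqF// half_gap_gt0.
  by field; rewrite hn hj.
- by apply: divr_ge0; [rewrite subr_ge0 ltW|apply: mulr_ge0 => //; exact: ltW].
- move=> j k /andP[_ /eqP ej] /andP[_ /eqP ek]; apply/val_inj => /=; lia.
- move=> j /andP[_ /eqP ej]; rewrite (K2inv_pred _ _ ej).
  rewrite (knot0S _ _ ej) (knot1S _ _ ej).
  have hj : half_gap j != 0 by rewrite gt_eqF// half_gap_gt0.
  by field; rewrite hn hj.
Qed.

Lemma K2inv_bounds (v : 'cV[R]_(n - 2)) :
  1 / 3 * (\sum_i v i 0 ^+ 2 / half_gap i) <= quadform (K2inv x) v <=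
  \sum_i v i 0 ^+ 2 / half_gap i.
Proof.
apply: diag_dominant_quadform.
- exact: half_gap_gt0.
- exact: K2inv_sym.
- exact: K2inv_ge0.
- by move=> i; rewrite K2inv_eq divfK// gt_eqF// half_gap_gt0.
- exact: K2inv_offdiag_sum.
Qed.

Lemma W2mxE : W2mx x = diag_mx (\row_i half_gap i).
Proof. by []. Qed.

Lemma K2_spectral :
  K2inv x \in unitmx /\ spectrally_similar 3 1 (K2mx x) (W2mx x).
Proof.
apply: invmx_spectrally_similar.
- exact: half_gap_gt0.
- exact: K2inv_sym.
- exact: K2inv_bounds.
Qed.

Lemma sqnorm2_sqrtW2mx (d : 'cV[R]_(n - 2)) :
  sqnorm2 (sqrtW2mx x *m d) = \sum_i half_gap i * d i 0 ^+ 2.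
Proof.
apply: eq_bigr => i _; rewrite mxE (bigD1 i)//= big1 ?addr0; last first.
  move=> j ji; rewrite !mxE eq_sym (negbTE ji) mulr0n.
  by rewrite sqrtr0 mul0r.
rewrite !mxE eqxx mulr1n exprMn sqr_sqrtr//.
exact/ltW/half_gap_gt0.
Qed.

Lemma D2mx_fun (F : R -> R) i : (D2mx x *m (\col_k F (x k))) i 0 =
  second_difference (x (knot0 i)) (x (knot1 i)) (x (knot2 i)) F.
Proof. by rewrite D2mxE !mxE. Qed.

Lemma D2mx_affine (c d : R) : D2mx x *m (\col_k (c + d * x k)) = 0.
Proof.
apply/colP => i; rewrite (D2mx_fun (fun t => c + d * t)) mxE /second_difference.
have h01 := knot0_lt_knot1 i; have h12 := knot1_lt_knot2 i.
have n1 : x (knot2 i) - x (knot1 i) != 0 by rewrite gt_eqF//; lra.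
have n2 : x (knot1 i) - x (knot0 i) != 0 by rewrite gt_eqF//; lra.
have n3 : x (knot2 i) - x (knot0 i) != 0 by rewrite gt_eqF//; lra.
by field; rewrite n1 n2 n3.
Qed.

Lemma truncpow_le0 m (t : R) : t <= 0 -> truncpow m t = 0.
Proof. by move=> t0; rewrite /truncpow ltNge t0. Qed.

Lemma truncpow_ge0 m (t : R) : 0 <= t -> truncpow m.+1 t = t ^+ m.+1.
Proof.
rewrite le_eqVlt => /predU1P[<-|t0]; first by rewrite /truncpow ltxx expr0n.
by rewrite /truncpow t0.
Qed.

Ltac truncpow_simpl := repeat match goal with |- context [truncpow 3 ?d] =>
  first [ rewrite (@truncpow_le0 3 d); [|lra]
        | rewrite (@truncpow_ge0 2 d); [|lra] ] end.

(** The kernel [(u - v)_+^3 / 6] is zero when the knots of [i] lie to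
    the left of those of [j]; when they lie to the right, it is a cubic in
    [u - v], killed by the two second differences. Only triples of knots that
    overlap in at least two points contribute. *)
Lemma K2inv_second_difference (i j : 'I_(n - 2)) :
  second_difference (x (knot0 i)) (x (knot1 i)) (x (knot2 i)) (fun u =>
    second_difference (x (knot0 j)) (x (knot1 j)) (x (knot2 j)) (fun v =>
      truncpow 3 (u - v) / 6)) = K2inv x i j.
Proof.
have i01 := knot0_lt_knot1 i; have i12 := knot1_lt_knot2 i.
have j01 := knot0_lt_knot1 j; have j12 := knot1_lt_knot2 j.
have n1 : x (knot2 i) - x (knot1 i) != 0 by rewrite gt_eqF//; lra.
have n2 : x (knot1 i) - x (knot0 i) != 0 by rewrite gt_eqF//; lra.
have n3 : x (knot2 i) - x (knot0 i) != 0 by rewrite gt_eqF//; lra.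
have m1 : x (knot2 j) - x (knot1 j) != 0 by rewrite gt_eqF//; lra.
have m2 : x (knot1 j) - x (knot0 j) != 0 by rewrite gt_eqF//; lra.
have m3 : x (knot2 j) - x (knot0 j) != 0 by rewrite gt_eqF//; lra.
have [ij|ij] := eqVneq i j.
  rewrite -{}ij {j j01 j12 m1 m2 m3} K2inv_eq /half_gap /second_difference.
  truncpow_simpl.
  by field; rewrite n1 n2 n3.
have [e|ne1] := eqVneq (i : nat) j.+1.
  rewrite (K2inv_succ _ _ e) /half_gap /second_difference.
  move: i01 i12 n1 n2 n3; rewrite (knot0S _ _ e) (knot1S _ _ e).
  move=> i01 i12 n1 n2 n3.
  by truncpow_simpl; field; rewrite ?n1 ?n2 ?n3 ?m1 ?m2 ?m3.
have [e|ne2] := eqVneq (j : nat) i.+1.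
  rewrite (K2inv_pred _ _ e) /half_gap /second_difference.
  move: j01 j12 m1 m2 m3; rewrite (knot0S _ _ e) (knot1S _ _ e).
  move=> j01 j12 m1 m2 m3.
  by truncpow_simpl; field; rewrite ?n1 ?n2 ?n3 ?m1 ?m2 ?m3.
rewrite K2inv_far// /second_difference.
have [ltij|ltji] := ltnP i j.
  have : x (knot2 i) <= x (knot0 j) by apply: knots_mono => /=; lia.
  move=> ?; truncpow_simpl; field; by rewrite ?n1 ?n2 ?n3 ?m1 ?m2 ?m3.
have ? : x (knot2 j) <= x (knot0 i).
  have ij' : (i : nat) != j by rewrite (inj_eq val_inj).
  by apply: knots_mono => /=; lia.
by truncpow_simpl; field; rewrite ?n1 ?n2 ?n3 ?m1 ?m2 ?m3.
Qed.

End Knots.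

(** * Natural splines and the two roughness bounds *)

Section NaturalSplines.
Context {R : realType} {n : nat} (x : 'I_n -> R) (a b : R).
Hypothesis hn : (3 <= n)%N.
Hypothesis hx : forall i j : 'I_n, (i < j)%N -> x i < x j.
Hypothesis hab : forall i : 'I_n, a <= x i <= b.
Local Notation mu := (@lebesgue_measure R).

Lemma knots_ab : a < b.
Proof.
have n0 : (0 < n)%N by exact: leq_trans hn.
have n1 : (1 < n)%N by exact: leq_trans hn.
have := hx (Ordinal n0) (Ordinal n1) isT.
have /andP[a0 _] := hab (Ordinal n0); have /andP[_ b1] := hab (Ordinal n1).
by move=> x01; exact: le_lt_trans a0 (lt_le_trans x01 b1).
Qed.

(** The weights of the knots when [v] is paired with the second differences. *)
Definition spline_coef (v : 'cV[R]_(n - 2)) : 'cV[R]_n := (D2mx x)^T *m v.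

(** For a unit vector [v] this is the hat function on three consecutive knots,
    divided by the corresponding [half_gap]. *)
Definition hat_comb (v : 'cV[R]_(n - 2)) (t : R) : R :=
  \sum_k spline_coef v k 0 * truncpow 1 (t - x k).

(** A second antiderivative of [hat_comb v]. *)
Definition cubic_comb (v : 'cV[R]_(n - 2)) (t : R) : R :=
  \sum_k spline_coef v k 0 * (truncpow 3 (t - x k) / 6).

Lemma spline_coef_dot v (F : 'I_n -> R) :
  \sum_k spline_coef v k 0 * F k =
  \sum_i v i 0 * (D2mx x *m \col_k F k) i 0.
Proof.
have := dotmxE _ (spline_coef v) (\col_k F k).
have := dotmxE _ v (D2mx x *m \col_k F k).
rewrite /spline_coef trmx_mul trmxK mulmxA => -> h.
by rewrite h; apply: eq_bigr => k _; rewrite mxE.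
Qed.

Lemma spline_coef_sum0 v : \sum_k spline_coef v k 0 = 0.
Proof.
have := spline_coef_dot v (fun k => 1 + 0 * x k).
rewrite (D2mx_affine _ hx) => h.
transitivity (\sum_k spline_coef v k 0 * (1 + 0 * x k)).
  by apply: eq_bigr => k _; rewrite mul0r addr0 mulr1.
by rewrite h big1// => i _; rewrite mxE mulr0.
Qed.

Lemma spline_coef_moment0 v : \sum_k spline_coef v k 0 * x k = 0.
Proof.
have := spline_coef_dot v (fun k => 0 + 1 * x k).
rewrite (D2mx_affine _ hx) => h.
transitivity (\sum_k spline_coef v k 0 * (0 + 1 * x k)).
  by apply: eq_bigr => k _; rewrite mul1r add0r.
by rewrite h big1// => i _; rewrite mxE mulr0.
Qed.

Lemma second_difference_sum (I : finType) (p q r : R) (c : I -> R)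
    (F : I -> R -> R) :
  second_difference p q r (fun t => \sum_j c j * F j t) =
  \sum_j c j * second_difference p q r (F j).
Proof.
rewrite /second_difference -!sumrB !mulr_suml -sumrB mulr_sumr.
by apply: eq_bigr => j _; ring.
Qed.

(** Pairing with [spline_coef v] is [v] paired with second differences, so
    the left-hand side is a double second difference of truncated cubes. *)
Lemma D2_cubic_comb v :
  D2mx x *m (\col_k cubic_comb v (x k)) = K2inv x *m v.
Proof.
apply/colP => i; rewrite D2mx_fun.
have -> : cubic_comb v = fun u => \sum_j v j 0 *
    second_difference (x (knot0 j)) (x (knot1 j)) (x (knot2 j))
      (fun w => truncpow 3 (u - w) / 6).
  apply/funext => u; rewrite /cubic_comb.
  rewrite (spline_coef_dot v (fun k => truncpow 3 (u - x k) / 6)).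
  by apply: eq_bigr => j _; rewrite (D2mx_fun _ (fun w => truncpow 3 (u - w) / 6)).
rewrite second_difference_sum mxE; apply: eq_bigr => j _.
by rewrite K2inv_second_difference// mulrC.
Qed.

(** A vanishing second difference determines each value from the two
    preceding ones, as an affine function of the knot. *)
Lemma D2mx_ker_affine (eta : 'cV[R]_n) : D2mx x *m eta = 0 ->
  exists c d, forall k, eta k 0 = c + d * x k.
Proof.
move=> D0.
have n0 : (0 < n)%N by exact: leq_trans hn.
have n1 : (1 < n)%N by exact: leq_trans hn.
pose k0 := Ordinal n0; pose k1 := Ordinal n1.
have x01 : x k0 < x k1 by exact: hx.
have xn : x k1 - x k0 != 0 by rewrite gt_eqF// subr_gt0.
pose d := (eta k1 0 - eta k0 0) / (x k1 - x k0).
exists (eta k0 0 - d * x k0), d.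
suff H m : forall h : (m < n)%N, eta (Ordinal h) 0 =
    eta k0 0 - d * x k0 + d * x (Ordinal h).
  by case=> m h; exact: H.
elim/ltn_ind: m => -[|[|m]] IH h.
- rewrite (_ : Ordinal h = k0); last exact/val_inj.
  by rewrite subrK.
- rewrite (_ : Ordinal h = k1); last exact/val_inj.
  by rewrite /d; field.
have hm : (m < n - 2)%N by lia.
pose i : 'I_(n - 2) := Ordinal hm.
have h0 : (m < n)%N by lia.
have h1 : (m.+1 < n)%N by lia.
have e0 : knot0 i = Ordinal h0 by apply/val_inj; rewrite /= addn0.
have e1 : knot1 i = Ordinal h1 by apply/val_inj; rewrite /= addn1.
have e2 : knot2 i = Ordinal h by apply/val_inj; rewrite /= addn2.
have := D2mxE x eta i; rewrite D0 mxE.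
have := knot0_lt_knot1 _ hx i; have := knot1_lt_knot2 _ hx i; rewrite e0 e1 e2.
have I0 := IH m (ltnW (ltnSn _)) h0; have I1 := IH m.+1 (ltnSn _) h1.
rewrite I0 I1.
set p := x (Ordinal h0); set q := x (Ordinal h1); set r := x (Ordinal h).
set c := eta k0 0 - d * x k0 => qr pq.
have rq0 : r - q != 0 by rewrite gt_eqF// subr_gt0.
have qp0 : q - p != 0 by rewrite gt_eqF// subr_gt0.
have rp0 : r - p != 0 by rewrite gt_eqF// subr_gt0 (lt_trans pq).
have -> : (c + d * q - (c + d * p)) / (q - p) = d by field.
move/esym/eqP; rewrite mulf_eq0 mulf_eq0 invr_eq0 (negbTE rp0) pnatr_eq0/=.
rewrite subr_eq0 => /eqP h2.
have := congr1 (fun z => z * (r - q)) h2; rewrite /= divfK//.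
by move=> h3; rewrite -[LHS](subrK (c + d * q)) h3; ring.
Qed.

Lemma truncpow_exp m (t : R) : truncpow m.+1 t = truncpow 1 t ^+ m.+1.
Proof. by rewrite /truncpow expr1; case: ifP; rewrite ?expr0n. Qed.

Lemma continuous_truncpow m : continuous (@truncpow R m.+1).
Proof.
have -> : truncpow m.+1 = (fun t : R => t ^+ m.+1) \o truncpow 1.
  by apply/funext => t; exact: truncpow_exp.
move=> t; apply: continuous_comp; first exact: continuous_truncpow1.
exact: exprn_continuous.
Qed.

(** At 0 the difference quotient is a truncated power of smaller
    exponent, which is continuous and zero there. *)
Lemma is_derive_truncpow m (t : R) :
  is_derive t (1 : R) (truncpow m.+2) (m.+2%:R * truncpow m.+1 t).
Proof.
have [t0|t0|->] := ltrgtP t 0.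
- rewrite [truncpow m.+1 t]truncpow_le0 ?ltW// mulr0.
  have : is_derive t (1 : R) (cst (0 : R)) 0 by exact: is_derive_cst.
  apply: near_eq_is_derive; near=> u; rewrite truncpow_le0//.
  by near: u; exact: lt_le_nbhsl.
- rewrite [truncpow m.+1 t]truncpow_ge0 ?ltW//.
  have : is_derive t (1 : R) (fun u => u ^+ m.+2) (m.+2%:R * t ^+ m.+1).
    apply: DeriveDef; first exact: exprn_derivable.
    by rewrite exp_derive /GRing.scale/= mulr1.
  apply: near_eq_is_derive; near=> u; rewrite truncpow_ge0//.
  by near: u; exact: lt_le_nbhsr.
- rewrite [truncpow m.+1 0]truncpow_le0// mulr0.
  have q0 : (fun h : R => h^-1 *: (truncpow m.+2 (h *: 1 + 0) - truncpow m.+2 0))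
      @ 0^' --> (0 : R).
    have c0 : truncpow m.+1 u @[u --> (0 : R)^'] --> (0 : R).
      rewrite -[X in _ --> X](truncpow_le0 m.+1 0)//.
      by apply: cvg_within_filter; exact: continuous_truncpow.
    apply: cvg_trans c0; apply: near_eq_cvg; near=> h.
    have h0 : h != 0 by near: h; exact: nbhs_dnbhs_neq.
    rewrite addr0 {1 2}/GRing.scale/= mulr1 [truncpow m.+2 0]truncpow_le0// subr0.
    by rewrite /truncpow; case: ifP => _; rewrite ?mulr0// [h ^+ m.+2]exprS mulKf.
  by apply: DeriveDef; [apply/cvg_ex; exists 0|exact: cvg_lim q0].
Unshelve. all: by end_near. Qed.

Lemma is_derive_shift_truncpow m (c t : R) :
  is_derive t (1 : R) (fun u => truncpow m.+2 (u - c))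
    (m.+2%:R * truncpow m.+1 (t - c)).
Proof.
have := is_derive_comp_affine (truncpow m.+2)
  (m.+2%:R * truncpow m.+1 (t - c)) 1 (- c) t.
rewrite !mul1r; under eq_fun do rewrite mul1r; apply.
exact: is_derive_truncpow.
Qed.

Lemma natural_spline v (c d : R) :
  let g t := cubic_comb v t + (c + d * t) in
  spline_space a b g /\ weak_second_derivative a b g (hat_comb v).
Proof.
move=> g; pose dg t := \sum_k spline_coef v k 0 * (truncpow 2 (t - x k) / 2) + d.
apply: (@C2_spline _ a b g dg (hat_comb v) knots_ab).
- move=> t; apply: is_derive_add; last first.
    by have := is_derive_affine d c t; under eq_fun do rewrite addrC.
  apply: (@is_derive_fsum _ _
    (fun k t => spline_coef v k 0 * (truncpow 3 (t - x k) / 6))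
    (fun k t => spline_coef v k 0 * (truncpow 2 (t - x k) / 2))) => k.
  apply: is_derive_scale.
  have := is_derive_scale _ 6^-1 _ _ (is_derive_shift_truncpow 1 (x k) t).
  rewrite (_ : 6^-1 * _ = truncpow 2 (t - x k) / 2); last by field.
  by under eq_fun do rewrite mulrC.
- move=> t; rewrite -[hat_comb v t]addr0.
  apply: (@is_derive_add _ (fun t => \sum_k spline_coef v k 0 *
    (truncpow 2 (t - x k) / 2)) (fun=> d)).
  apply: (@is_derive_fsum _ _
    (fun k t => spline_coef v k 0 * (truncpow 2 (t - x k) / 2))
    (fun k t => spline_coef v k 0 * truncpow 1 (t - x k))) => k.
  apply: is_derive_scale.
  have := is_derive_scale _ 2^-1 _ _ (is_derive_shift_truncpow 0 (x k) t).
  rewrite (_ : 2^-1 * _ = truncpow 1 (t - x k)); last by field.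
  by under eq_fun do rewrite mulrC.
- exact: continuous_kernel.
Qed.

Lemma continuous_hat_comb v : continuous (hat_comb v).
Proof. exact: continuous_kernel. Qed.

Lemma integrable_hat_comb v : mu.-integrable `[a, b] (EFin \o hat_comb v).
Proof.
apply: continuous_compact_integrable; first exact: segment_compact.
exact/continuous_subspaceT/continuous_hat_comb.
Qed.

Lemma integral_hat_comb f h v : {within `[a, b], continuous f} ->
  weak_second_derivative a b f h -> mu.-integrable `[a, b] (EFin \o h) ->
  \int[mu]_(t in `[a, b]) (h t * hat_comb v t) =
  \sum_i v i 0 * (D2mx x *m \col_k f (x k)) i 0.
Proof.
move=> cf fh ih; rewrite -spline_coef_dot; apply: peano_kernel fh ih hab _ _ => //.
- exact: knots_ab.
- exact: spline_coef_sum0.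
- exact: spline_coef_moment0.
Qed.

(** Peano's identity for the natural spline whose second derivative is
    [hat_comb v]. *)
Lemma integral_hat_comb_sqr v :
  \int[mu]_(t in `[a, b]) (hat_comb v t ^+ 2) = quadform (K2inv x) v.
Proof.
have [sg wg] := natural_spline v 0 0.
have [cg _ _ _] := sg.
under eq_Rintegral do rewrite expr2.
rewrite (integral_hat_comb _ _ v cg wg (integrable_hat_comb v)).
have -> : \col_k (cubic_comb v (x k) + (0 + 0 * x k)) =
    \col_k cubic_comb v (x k) by apply/colP => k; rewrite !mxE mul0r !addr0.
by rewrite D2_cubic_comb -dotmxE mulmxA.
Qed.

(** Let [s] be the hat combination with coefficients
    [v i = half_gap i * (D f(x)) i]. Its pairing with [f''] is the left-hand
    side [S], and its square integral is at most [S] because [K^-1 <= W^-1].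
    Integrating [f''^2 >= 2 * f'' * s - s^2] gives [2 S - S]. *)
Lemma roughness_lower_bound f : spline_space a b f ->
  \sum_i half_gap x i * (D2mx x *m \col_k f (x k)) i 0 ^+ 2 <= roughness a b f.
Proof.
move=> sf; pose v := \col_i (half_gap x i * (D2mx x *m \col_k f (x k)) i 0).
set S := \sum_i _.
have [cf _ _ _] := sf; have fh := spline_weak_D2 _ _ _ sf.
have ih := weak_D2_integrable _ _ _ sf.
have i2 := weak_D2_sqr_integrable _ _ _ sf.
have hS : \int[mu]_(t in `[a, b]) (weak_D2 a b f t * hat_comb v t) = S.
  rewrite (integral_hat_comb _ _ _ cf fh ih); apply: eq_bigr => i _.
  by rewrite mxE; ring.
have ss : \int[mu]_(t in `[a, b]) (hat_comb v t ^+ 2) <= S.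
  rewrite integral_hat_comb_sqr; have /andP[_ /le_trans] := K2inv_bounds _ hx v.
  apply; rewrite le_eqVlt; apply/orP; left; apply/eqP; apply: eq_bigr => i _.
  have hg : half_gap x i != 0 by rewrite gt_eqF// half_gap_gt0.
  by rewrite mxE; field.
have ihs : mu.-integrable `[a, b]
    (EFin \o (fun t => weak_D2 a b f t * hat_comb v t)).
  exact: integrable_continuousM ih (continuous_hat_comb v).
have is2 : mu.-integrable `[a, b] (EFin \o (fun t => hat_comb v t ^+ 2)).
  have := integrable_continuousM _ _ _ _ (integrable_hat_comb v)
    (continuous_hat_comb v).
  by congr (is_true (integrable _ _ _)); apply/funext => t; rewrite /= expr2.
have : \int[mu]_(t in `[a, b])
    (2 * (weak_D2 a b f t * hat_comb v t) + (-1) * hat_comb v t ^+ 2) <=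
    roughness a b f.
  apply: le_Rintegral => //; first exact: integrable_lincomb.
  move=> t _; set p := weak_D2 a b f t; set q := hat_comb v t.
  by have := sqr_ge0 (p - q); rewrite !expr2; lra.
by rewrite Rintegral_lincomb// hS; lra.
Qed.

(** The natural cubic spline interpolant. With [v = K D theta] the cubic
    combination has the right second differences, so an affine correction makes
    it interpolate [theta]. Its roughness is [(D theta)^T K (D theta)], and
    [K <= 3 W]. *)
Lemma spline_interpolant (theta : 'cV[R]_n) : exists g,
  [/\ spline_space a b g, forall k, g (x k) = theta k 0 &
    roughness a b g <=
      3 * \sum_i half_gap x i * (D2mx x *m theta) i 0 ^+ 2].
Proof.
have [Au spec] := K2_spectral _ hx.
pose v := K2mx x *m (D2mx x *m theta).
have Kv : K2inv x *m v = D2mx x *m theta.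
  by rewrite /v mulmxA mulmxV// mul1mx.
have : D2mx x *m (theta - \col_k cubic_comb v (x k)) = 0.
  by rewrite mulmxBr D2_cubic_comb Kv subrr.
move=> /D2mx_ker_affine[c [d eta]].
have [sg wg] := natural_spline v c d.
exists (fun t => cubic_comb v t + (c + d * t)); split=> //.
  by move=> k; have := eta k; rewrite !mxE => <-; ring.
rewrite (roughnessE _ _ _ _ sg wg) integral_hat_comb_sqr.
have [_ _ _ _ /(_ (D2mx x *m theta))/andP[_]] := spec.
rewrite W2mxE quadform_diag; congr (_ <= _).
rewrite /quadform -!mulmxA Kv -/v !dotmxE.
by apply: eq_bigr => i _; rewrite mulrC.
Qed.

End NaturalSplines.

(** * First order conditions and the comparison *)

Section FirstOrder.
Context {R : realType}.

(** If [p] were negative, the bound would fail at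
    [t = - p / (- p + |q|)]. *)
Lemma first_order_ge0 (p q : R) :
  (forall t, 0 < t <= 1 -> 0 <= t * p + t ^+ 2 * q) -> 0 <= p.
Proof.
move=> h; have [//|p0] := leP 0 p.
have d0 : 0 < - p + `|q| by have := normr_ge0 q; lra.
have t01 : 0 < - p / (- p + `|q|) <= 1.
  by rewrite divr_gt0 ?oppr_gt0//= ler_pdivrMr// mul1r lerDl.
have := h _ t01; set t := - p / _ in t01 *; have /andP[t0 _] := t01.
rewrite expr2 -mulrA -mulrDr pmulr_rge0// => ptq.
have tE : t * (- p + `|q|) = - p by rewrite /t divfK// gt_eqF.
have tq : t * q <= t * `|q| by rewrite ler_pM2l// ler_norm.
have tp : 0 < t * - p by rewrite mulr_gt0// oppr_gt0.
by rewrite mulrDr in tE; lra.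
Qed.

Lemma sqnorm2_sub N (u v : 'cV[R]_N) (t : R) :
  sqnorm2 (u - t *: v) =
  sqnorm2 u - 2 * t * (\sum_i u i 0 * v i 0) + t ^+ 2 * sqnorm2 v.
Proof.
rewrite /sqnorm2 !mulr_sumr -sumrB -big_split; apply: eq_bigr => i _ /=.
by rewrite !mxE; ring.
Qed.

Lemma wsum_sqr_add N (w : 'I_N -> R) (u v : 'cV[R]_N) (t : R) :
  \sum_i w i * (u + t *: v) i 0 ^+ 2 =
  \sum_i w i * u i 0 ^+ 2 + 2 * t * (\sum_i w i * (u i 0 * v i 0)) +
  t ^+ 2 * (\sum_i w i * v i 0 ^+ 2).
Proof.
rewrite !mulr_sumr -!big_split; apply: eq_bigr => i _ /=.
by rewrite !mxE; ring.
Qed.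

(** The constants are the ones that match in the comparison: 1/3 is the
    constant of the final bound, which forces 3/4 for the other term. *)
Lemma wsum_young N (w u v : 'I_N -> R) : (forall i, 0 < w i) ->
  \sum_i w i * (u i * v i) <=
  3 / 4 * \sum_i w i * u i ^+ 2 + 1 / 3 * \sum_i w i * v i ^+ 2.
Proof.
move=> w0; rewrite !mulr_sumr -big_split; apply: ler_sum => i _ /=.
have -> : 3 / 4 * (w i * u i ^+ 2) + 1 / 3 * (w i * v i ^+ 2) =
    w i * (u i * v i) + 3 / 4 * w i * (u i - 2 / 3 * v i) ^+ 2 by field.
rewrite lerDl mulr_ge0 ?sqr_ge0// mulr_ge0//; last exact/ltW/w0.
Qed.

(** The [wb] terms have coefficient [lb * 3/4 - lb + la * 3/4], which is
    nonpositive as [3 * la <= lb]. *)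
Lemma comparison_arith (la lb p q cr wa wb ra rg : R) :
  0 <= la -> 3 * la <= lb -> 0 <= wb -> p <= lb * (cr - wb) ->
  q <= la / 4 * rg -> cr <= 3 / 4 * wb + 1 / 3 * wa -> wa <= ra ->
  rg <= 3 * wb -> p + q <= lb / 3 * ra.
Proof.
move=> la0 lab wb0 pb qb young low up; have lb0 : 0 <= lb by lra.
have h1 : lb * cr <= lb * (3 / 4 * wb + 1 / 3 * wa) by exact: ler_wpM2l.
have h2 : lb * wa <= lb * ra by exact: ler_wpM2l.
have h3 : la * rg <= la * (3 * wb) by exact: ler_wpM2l.
have h4 : 3 * la * wb <= lb * wb by exact: ler_wpM2r.
lra.
Qed.

Lemma sum_sqr_interp (I : finType) (y p q : I -> R) (t : R) :
  \sum_i (y i - ((1 - t) * p i + t * q i)) ^+ 2 =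
  \sum_i (y i - p i) ^+ 2 - 2 * t * (\sum_i (y i - p i) * (q i - p i)) +
  t ^+ 2 * \sum_i (q i - p i) ^+ 2.
Proof.
by rewrite !mulr_sumr -sumrB -big_split; apply: eq_bigr => i _ /=; ring.
Qed.

End FirstOrder.

Section Comparison.
Context {R : realType} {n : nat} (x : 'I_n -> R) (a b : R).
Hypothesis hn : (3 <= n)%N.
Hypothesis hx : forall i j : 'I_n, (i < j)%N -> x i < x j.
Hypothesis hab : forall i : 'I_n, a <= x i <= b.
Local Notation mu := (@lebesgue_measure R).

(** The objective is quadratic along the segment from the minimiser in the
    direction [d], so its linear coefficient there is nonnegative. *)
Lemma BW_first_order (y thetahat d : 'cV[R]_n) (lambda : R) :
  BW_solution x y lambda thetahat ->
  \sum_i (y - thetahat) i 0 * d i 0 <=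
  lambda * \sum_i half_gap x i *
    ((D2mx x *m thetahat) i 0 * (D2mx x *m d) i 0).
Proof.
move=> opt; set P := \sum_i _; set B := \sum_i _.
suff : 0 <= 2 * (lambda * B - P) by lra.
apply: (@first_order_ge0 _ _ (sqnorm2 d +
  lambda * \sum_i half_gap x i * (D2mx x *m d) i 0 ^+ 2)) => t _.
have := opt (thetahat + t *: d).
rewrite /BW_objective opprD addrA sqnorm2_sub -/P mulmxDr -scalemxAr.
rewrite !sqnorm2_sqrtW2mx// wsum_sqr_add -/B.
by rewrite -subr_ge0; congr (0 <= _); ring.
Qed.

Lemma objective_step (s p q r rf rg l t : R) :
  s + l * rf <= s - 2 * t * p + t ^+ 2 * q + l * r ->
  l * r <= l * ((1 + 2 * t ^+ 2) * rf + (t / 2 + 2 * t ^+ 2) * rg) ->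
  0 <= t * (- 2 * p + l / 2 * rg) + t ^+ 2 * (q + l * (2 * rf + 2 * rg)).
Proof. lra. Qed.

(** To first order in [t] the left-hand side is [p^2 - 2 t p^2 + 2 t p q], and
    [2 p q <= 2 p^2 + q^2 / 2]. The bound involves squares only, so that it can
    be integrated without the mixed integral. *)
Lemma sqr_interp_le (t p q : R) : 0 < t <= 1 ->
  ((1 - t) * p + t * q) ^+ 2 <=
  (1 + 2 * t ^+ 2) * p ^+ 2 + (t / 2 + 2 * t ^+ 2) * q ^+ 2.
Proof.
move=> /andP[t0 _]; rewrite -subr_ge0.
have -> : (1 + 2 * t ^+ 2) * p ^+ 2 + (t / 2 + 2 * t ^+ 2) * q ^+ 2 -
    ((1 - t) * p + t * q) ^+ 2 =
    2 * t * (p - q / 2) ^+ 2 + t ^+ 2 * (p + q) ^+ 2 by field.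
by rewrite addr_ge0// mulr_ge0 ?sqr_ge0// mulr_ge0// ltW.
Qed.

Lemma integral_sqr_interp_le (D : set R) (h k : R -> R) (t : R) :
  measurable D -> 0 < t <= 1 -> measurable_fun D h -> measurable_fun D k ->
  mu.-integrable D (EFin \o (fun u => h u ^+ 2)) ->
  mu.-integrable D (EFin \o (fun u => k u ^+ 2)) ->
  \int[mu]_(u in D) (((1 - t) * h u + t * k u) ^+ 2) <=
  (1 + 2 * t ^+ 2) * \int[mu]_(u in D) (h u ^+ 2) +
  (t / 2 + 2 * t ^+ 2) * \int[mu]_(u in D) (k u ^+ 2).
Proof.
move=> mD t01 mh mk ih ik; rewrite -Rintegral_lincomb//.
apply: le_Rintegral => //.
- exact: integrable_sqr_lincomb.
- exact: integrable_lincomb.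
- by move=> u _; exact: sqr_interp_le.
Qed.

Lemma roughness_interp_le f g (t : R) : 0 < t <= 1 ->
  spline_space a b f -> spline_space a b g ->
  spline_space a b (fun u => (1 - t) * f u + t * g u) /\
  roughness a b (fun u => (1 - t) * f u + t * g u) <=
  (1 + 2 * t ^+ 2) * roughness a b f + (t / 2 + 2 * t ^+ 2) * roughness a b g.
Proof.
move=> t01 sf sg; have [ss ->] := spline_space_lincomb _ _ _ _ (1 - t) t sf sg.
split=> //; apply: integral_sqr_interp_le t01 _ _ _ _.
- exact: measurable_itv.
- exact: weak_D2_measurable.
- exact: weak_D2_measurable.
- exact: weak_D2_sqr_integrable.
- exact: weak_D2_sqr_integrable.
Qed.

(** The spline is moved towards [g]. To first order, its roughness
    increases by at most half the roughness of [g]. *)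
Lemma spline_first_order (y : 'cV[R]_n) (lambda : R) (f g : R -> R) :
  0 <= lambda -> spline_solution a b x y lambda f -> spline_space a b g ->
  \sum_i (y i 0 - f (x i)) * (g (x i) - f (x i)) <=
  lambda / 4 * roughness a b g.
Proof.
move=> l0 [sf opt] sg; set P := \sum_i _.
set rf := roughness a b f; set rg := roughness a b g.
suff : 0 <= - 2 * P + lambda / 2 * rg by lra.
apply: (@first_order_ge0 _ _ (\sum_i (g (x i) - f (x i)) ^+ 2 +
  lambda * (2 * rf + 2 * rg))) => t t01.
have [ss rle] := roughness_interp_le f g t t01 sf sg.
have := opt _ ss; rewrite /spline_objective -/rf.
have := ler_wpM2l l0 rle; rewrite -/rf -/rg.
move=> h1; rewrite sum_sqr_interp -/P => h2.
exact: objective_step h2 h1.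
Qed.

End Comparison.

Theorem theorem7 (R : realType) (n : nat) (a b : R) (x : 'I_n -> R)
    (hn : (3 <= n)%N)
    (hx : forall i j : 'I_n, (i < j)%N -> x i < x j)
    (hab : forall i : 'I_n, a <= x i <= b) :
  spectrally_similar 3 1 (K2mx x) (W2mx x) /\
  forall (y : 'cV[R]_n) (lambda_a lambda_b : R)
         (fhat : R -> R) (thetahat : 'cV[R]_n),
    0 <= lambda_a ->
    3 * lambda_a <= lambda_b ->
    spline_solution a b x y lambda_a fhat ->
    BW_solution x y lambda_b thetahat ->
    sqnorm2 (\col_i fhat (x i) - thetahat) <=
      lambda_b / 3 * roughness a b fhat.
Proof.
split; first by have [] := K2_spectral x hx.
move=> y la lb f th la0 lab fsol thsol.
have [sf _] := fsol.
set ta := \col_i f (x i); set d := ta - th.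
have [g [sg gth up]] := spline_interpolant x a b hn hx hab th.
have normd : sqnorm2 d = \sum_i (y - th) i 0 * d i 0 +
    \sum_i (y i 0 - f (x i)) * (g (x i) - f (x i)).
  rewrite /sqnorm2 -big_split; apply: eq_bigr => i _ /=.
  by rewrite gth !mxE; ring.
have splitB : \sum_i half_gap x i *
    ((D2mx x *m th) i 0 * (D2mx x *m d) i 0) =
    \sum_i half_gap x i * ((D2mx x *m th) i 0 * (D2mx x *m ta) i 0) -
    \sum_i half_gap x i * (D2mx x *m th) i 0 ^+ 2.
  have subE (p q : 'cV[R]_(n - 2)) i : (p - q) i 0 = p i 0 - q i 0.
    by rewrite !mxE.
  by rewrite /d mulmxBr -sumrB; apply: eq_bigr => i _; rewrite subE; ring.
rewrite normd; apply: (comparison_arith la lb _ _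
  (\sum_i half_gap x i * ((D2mx x *m th) i 0 * (D2mx x *m ta) i 0))
  _ (\sum_i half_gap x i * (D2mx x *m th) i 0 ^+ 2) _ (roughness a b g) la0 lab).
- apply: sumr_ge0 => i _; apply: mulr_ge0; last exact: sqr_ge0.
  exact/ltW/half_gap_gt0.
- rewrite -splitB; exact: (BW_first_order x hx y th d lb thsol).
- exact: (spline_first_order x a b y la f g la0 fsol sg).
- by apply: wsum_young; exact: half_gap_gt0.
- exact: (roughness_lower_bound x a b hn hx hab f sf).
- exact: up.
Qed.
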